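(* Let $(x_n,y_n)$ be a sequence of pairwise distinct pairs of natural numbers such that $x_n\le y_n$ for all $n$, the sequence $(x_n)$ is lower semicomputable, the sequence $(y_n)$ is upper semicomputable, and $\sum_n 2^{x_n-y_n}=+\infty$. Then: (i) there exists $n$ such that $B(x_n)>\mathrm{BP}'(y_n)$; (ii) there exists $n$ such that $\mathrm{BP}'(x_n)>\mathrm{BP}(y_n)$.
   Context: Fix an optimal (plain) decompressor $D$; $\mathrm{KS}(N)$ denotes the plain Kolmogorov complexity of $N$, i.e. the minimal length of a string $p$ with $D(p)=N$. Fix an optimal prefix-free decompressor; $\mathrm{KP}(N)$ denotes the resulting prefix Kolmogorov complexity. Fix a discrete a priori probability $\mathbf m$: a lower semicomputable sequence of non-negative reals $\mathbf m(k)$ with $\sum_k \mathbf m(k)$ convergent that is maximal up to a multiplicative constant among all such sequences (so $\mathbf m(k)=2^{-\mathrm{KP}(k)+O(1)}$). Define $B(n)=\max\{N : \mathrm{KS}(N)\le n\}$, $\mathrm{BP}(n)=\max\{N:\mathrm{KP}(N)\le n\}$, and $\mathrm{BP}'(n)$ = the minimal $N$ such that $\sum_{k>N}\mathbf m(k)<2^{-n}$. A sequence $(y_n)$ of natural numbers is lower (resp. upper) semicomputable if $y_n=\lim_k y(n,k)$ for a total computable function $y(\cdot,\cdot)$ non-decreasing (resp. non-increasing) in $k$. *)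

(* Defs.v *)
From HB Require Import structures.
From mathcomp Require Import all_boot all_order all_algebra.
From mathcomp Require Import all_classical all_reals all_analysis.

Set Implicit Arguments.
Unset Strict Implicit.
Unset Printing Implicit Defensive.

Import Order.TTheory GRing.Theory Num.Theory.
Import numFieldNormedType.Exports.

Local Open Scope classical_set_scope.
Local Open Scope ring_scope.

Inductive recf : nat -> Type :=
| RZero n : recf n
| RSucc : recf 1
| RProj n : 'I_n -> recf n
| RComp m n : recf m -> ('I_m -> recf n) -> recf n
| RPrec n : recf n -> recf n.+2 -> recf n.+1
| RMu n : recf n.+1 -> recf n.

(* [eval f v z]: the partial function coded by [f] converges on [v] with
   value [z].  For [RPrec f g] the recursion is on the first argument:
   h(0, w) = f(w) and h(i+1, w) = g(i, h(i, w), w).  For [RMu f] the value is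
   the least z with f(z, v) = 0, all earlier values being defined. *)
Fixpoint eval (n : nat) (f : recf n) : n.-tuple nat -> nat -> Prop :=
  match f in recf n return n.-tuple nat -> nat -> Prop with
  | RZero _ => fun _ z => z = 0%N
  | RSucc => fun v z => z = (thead v).+1
  | RProj _ i => fun v z => z = tnth v i
  | RComp m _ f g => fun v z =>
      exists w : m.-tuple nat, (forall i, eval (g i) v (tnth w i)) /\ eval f w z
  | RPrec n f g => fun v =>
      let w : n.-tuple nat := [tuple of behead v] in
      (fix prec (k : nat) : nat -> Prop :=
         match k with
         | 0 => eval f w
         | i.+1 => fun z =>
             exists u, prec i u /\ eval g [tuple of i :: u :: w] z
         end) (thead v)
  | RMu _ f => fun v z =>
      eval f [tuple of z :: v] 0%N /\
      (forall i, (i < z)%N -> exists u, eval f [tuple of i :: v] u.+1)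
  end.

Definition computable2 (f : nat -> nat -> nat) : Prop :=
  exists c : recf 2, forall i j, eval c [tuple i; j] (f i j).

(* The bijection between binary strings and natural numbers given by bijective
   base-2 notation (least significant digit first). *)
Fixpoint string_code (p : seq bool) : nat :=
  if p is b :: q then ((string_code q).*2 + b).+1 else 0%N.

(* Decompressors are partial computable functions from strings to naturals;
   [None] stands for divergence. *)
Definition decompressor (D : seq bool -> option nat) : Prop :=
  exists c : recf 1, forall p N,
    D p = Some N <-> eval c [tuple string_code p] N.

Definition is_min (A : set nat) (k : nat) : Prop :=
  A k /\ forall l, A l -> (k <= l)%N.

Definition is_max (A : set nat) (k : nat) : Prop :=
  A k /\ forall l, A l -> (l <= k)%N.

(* [is_complexity D N k]: the complexity of [N] with respect to [D] is the
   natural number [k].  There is no such [k] when [N] has no description. *)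
Definition is_complexity (D : seq bool -> option nat) (N k : nat) : Prop :=
  is_min [set size p | p in [set p | D p = Some N]] k.

Definition complexity_le (D : seq bool -> option nat) (N n : nat) : Prop :=
  exists k, is_complexity D N k /\ (k <= n)%N.

(* K_D <= K_E + O(1), complexities being infinite when there is no
   description. *)
Definition not_worse (D E : seq bool -> option nat) : Prop :=
  exists c : nat, forall N k, is_complexity E N k -> complexity_le D N (k + c).

Definition optimal_decompressor (D : seq bool -> option nat) : Prop :=
  decompressor D /\ forall E, decompressor E -> not_worse D E.

Definition prefix_free (D : seq bool -> option nat) : Prop :=
  forall p q, D p <> None -> D q <> None -> prefix p q -> p = q.

Definition prefix_decompressor (D : seq bool -> option nat) : Prop :=
  decompressor D /\ prefix_free D.

Definition optimal_prefix_decompressor (D : seq bool -> option nat) : Prop :=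
  prefix_decompressor D /\ forall E, prefix_decompressor E -> not_worse D E.

(* A computable array of rationals is presented as (a - b) / (c + 1) with
   a, b, c total computable. *)
Definition computable_ratio (R : realType) (q : nat -> nat -> R) : Prop :=
  exists a b c : nat -> nat -> nat,
    [/\ computable2 a, computable2 b, computable2 c &
      forall k i, q k i = ((a k i)%:R - (b k i)%:R) / (c k i).+1%:R].

Definition lower_semicomputable_real (R : realType) (m : nat -> R) : Prop :=
  exists q : nat -> nat -> R,
    [/\ computable_ratio q,
        forall k i j, (i <= j)%N -> q k i <= q k j &
        forall k, q k i @[i --> \oo] --> m k].

Definition summable_lsc (R : realType) (m : nat -> R) : Prop :=
  [/\ lower_semicomputable_real m, forall k, 0 <= m k & cvgn (series m)].

Definition apriori_probability (R : realType) (m : nat -> R) : Prop :=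
  summable_lsc m /\
  forall m' : nat -> R, summable_lsc m' ->
    exists C : R, 0 < C /\ forall k, m' k <= C * m k.

(* [is_B D n M]: M is the largest number of D-complexity at most n.  This is
   B(n) for an optimal plain D and BP(n) for an optimal prefix-free D. *)
Definition is_B (D : seq bool -> option nat) (n M : nat) : Prop :=
  is_max [set N | complexity_le D N n] M.

Definition is_BP' (R : realType) (m : nat -> R) (n M : nat) : Prop :=
  is_min [set N | (\sum_(N.+1 <= k <oo) (m k)%:E < (2 ^- n)%:E)%E] M.

Definition lower_semicomputable (x : nat -> nat) : Prop :=
  exists f : nat -> nat -> nat,
    [/\ computable2 f, forall n i j, (i <= j)%N -> (f n i <= f n j)%N &
        forall n, f n k @[k --> \oo] --> x n].

Definition upper_semicomputable (y : nat -> nat) : Prop :=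
  exists f : nat -> nat -> nat,
    [/\ computable2 f, forall n i j, (i <= j)%N -> (f n j <= f n i)%N &
        forall n, f n k @[k --> \oo] --> y n].

(* Main.v *)
(* Both parts play a game against the a priori probability, resp. against the
   prefix-free decompressor, using approximations from below to x and from above
   to y; every demand made with approximate values is implied by the limit ones.
   As the sum diverges, for each constant c one can compute a finite stage K_c at
   which the distinct approximate pairs with x > 2c already have a large sum of
   2^(x-y).

   (i) For every c, the strings of length x - c in the share of c are issued one
   by one as descriptions of larger and larger numbers v.  If B(x_n) <= BP'(y_n)
   always held, m would have to put mass 2^-y beyond each v; we wait until it does
   and continue beyond that place.  Each pair thus costs m about 2^(x-2c) 2^-y,
   in total more than its sum.

   (ii) For every c, a semimeasure puts 2^K_c equal weights, each at a point beyond
   all numbers described so far and only when for each pair (x, y) some program of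
   length <= y outputs a number beyond which the weight is smaller than
   2^(2c-x).  If BP'(x_n) <= BP(y_n) always held, the game would never be stuck, so
   at least 2^(x-2c-1) programs of length <= y would halt for each pair,
   contradicting Kraft's inequality. *)
Require Import Defs.
From mathcomp Require Import all_boot all_order all_algebra.
From mathcomp Require Import all_classical all_reals all_analysis.
From mathcomp Require Import zify ring lra.

Set Implicit Arguments.
Unset Strict Implicit.
Unset Printing Implicit Defensive.

Import Order.TTheory GRing.Theory Num.Theory.
Import numFieldNormedType.Exports.

Local Notation eval := Defs.eval.

(** * Total recursive functions *)

(* [F] matters only on lists of length [n]. *)
Definition rec n (F : seq nat -> nat) :=
  exists c : recf n, forall v : n.-tuple nat, eval c v (F v).

Lemma rec_ext n (F G : seq nat -> nat) :
  (forall v : n.-tuple nat, F v = G v) -> rec n F -> rec n G.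
Proof. by move=> FG [c cF]; exists c => v; rewrite -FG. Qed.

Lemma rec0 n : rec n (fun=> 0).
Proof. by exists (RZero n). Qed.

Lemma rec_nth n k : rec n (fun v => nth 0 v k).
Proof.
case: (ltnP k n) => kn.
  by exists (RProj (Ordinal kn)) => v /=; rewrite (tnth_nth 0).
by apply: rec_ext (rec0 n) => v; rewrite nth_default ?size_tuple.
Qed.

Lemma nth_map_enum m (H : 'I_m -> nat) (j : 'I_m) :
  nth 0 [seq H i | i <- enum 'I_m] j = H j.
Proof. by rewrite (nth_map j) ?size_enum_ord // nth_ord_enum. Qed.

Lemma rec_comp m n G (F : 'I_m -> seq nat -> nat) :
  rec m G -> (forall i, rec n (F i)) ->
  rec n (fun v => G [seq F i v | i <- enum 'I_m]).
Proof.
move=> [c cG] /choice[g gF]; exists (RComp c g) => v /=.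
exists [tuple F i v | i < m]; split; last exact: cG.
by move=> i; rewrite tnth_mktuple.
Qed.

Definition rec1 f := rec 1 (fun v => f (nth 0 v 0)).
Definition rec2 f := rec 2 (fun v => f (nth 0 v 0) (nth 0 v 1)).
Definition rec3 f := rec 3 (fun v => f (nth 0 v 0) (nth 0 v 1) (nth 0 v 2)).
Definition rec4 f :=
  rec 4 (fun v => f (nth 0 v 0) (nth 0 v 1) (nth 0 v 2) (nth 0 v 3)).

Lemma app1 f : rec1 f -> forall n A, rec n A -> rec n (fun v => f (A v)).
Proof.
move=> rf n A rA.
apply: rec_ext (rec_comp rf (F := fun _ => A) (fun=> rA)) => v.
by rewrite (nth_map_enum _ (Ordinal (isT : 0 < 1))).
Qed.

Lemma app2 f : rec2 f -> forall n A B, rec n A -> rec n B ->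
  rec n (fun v => f (A v) (B v)).
Proof.
move=> rf n A B rA rB.
apply: rec_ext (rec_comp rf (F := fun i => nth A [:: A; B] i) _) => [v|].
  rewrite (nth_map_enum _ (Ordinal (isT : 0 < 2))).
  by rewrite (nth_map_enum _ (Ordinal (isT : 1 < 2))).
by case=> -[|[]].
Qed.

Lemma app3 f : rec3 f -> forall n A B C, rec n A -> rec n B -> rec n C ->
  rec n (fun v => f (A v) (B v) (C v)).
Proof.
move=> rf n A B C rA rB rC.
apply: rec_ext (rec_comp rf (F := fun i => nth A [:: A; B; C] i) _) => [v|].
  rewrite (nth_map_enum _ (Ordinal (isT : 0 < 3))).
  rewrite (nth_map_enum _ (Ordinal (isT : 1 < 3))).
  by rewrite (nth_map_enum _ (Ordinal (isT : 2 < 3))).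
by case=> -[|[|[]]].
Qed.

Lemma app4 f : rec4 f -> forall n A B C D, rec n A -> rec n B -> rec n C ->
  rec n D -> rec n (fun v => f (A v) (B v) (C v) (D v)).
Proof.
move=> rf n A B C D rA rB rC rD.
apply: rec_ext (rec_comp rf (F := fun i => nth A [:: A; B; C; D] i) _) => [v|].
  rewrite (nth_map_enum _ (Ordinal (isT : 0 < 4))).
  rewrite (nth_map_enum _ (Ordinal (isT : 1 < 4))).
  rewrite (nth_map_enum _ (Ordinal (isT : 2 < 4))).
  by rewrite (nth_map_enum _ (Ordinal (isT : 3 < 4))).
by case=> -[|[|[|[]]]].
Qed.

Lemma computable2_rec2 f : computable2 f <-> rec2 f.
Proof.
split=> -[c cf]; exists c.
  case=> -[|a [|b []]] // sz.
  by have -> : Tuple sz = [tuple a; b] by [exact: val_inj]; exact: cf.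
by move=> a b; exact: (cf [tuple a; b]).
Qed.

(** Argument lists get rebuilt by dropping and prepending entries. Such a rearrangement is
    controlled coordinate by coordinate; positions past the end read the default 0. *)
Definition proj_env n (d : seq nat -> seq nat) :=
  forall k, rec n (fun v => nth 0 (d v) k).

Lemma proj_id n : proj_env n id.
Proof. exact: rec_nth. Qed.

Lemma proj_drop n d a : proj_env n d -> proj_env n (fun v => drop a (d v)).
Proof. by move=> dP k; apply: rec_ext (dP (a + k)) => v; rewrite nth_drop. Qed.

Lemma proj_cons n d F : rec n F -> proj_env n d ->
  proj_env n (fun v => F v :: d v).
Proof. by move=> rF dP [|k]; [exact: rF|exact: dP]. Qed.

Lemma rec_env n m G (d : seq nat -> seq nat) :
  (forall v : n.-tuple nat, size (d v) = m) ->
  rec m G -> proj_env n d -> rec n (fun v => G (d v)).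
Proof.
move=> sz rG dP.
apply: rec_ext (rec_comp rG (F := fun i v => nth 0 (d v) i) (fun i => dP i)).
move=> v; congr G; apply: (@eq_from_nth _ 0).
  by rewrite size_map size_enum_ord sz.
by move=> i; rewrite size_map size_enum_ord => im; rewrite (nth_map_enum _ (Ordinal im)).
Qed.

Lemma eval_prec n (f : recf n) (g : recf n.+2) (v : n.+1.-tuple nat) F G :
  eval f [tuple of behead v] F ->
  (forall i u, eval g [tuple of i :: u :: [tuple of behead v]] (G i u)) ->
  eval (RPrec f g) v (iteri (thead v) G F).
Proof.
move=> fF gG /=; elim: (thead v) => [|k IH] //=.
by exists (iteri k G F).
Qed.

Lemma rec_prec n F G : rec n F ->
  rec n.+2 (fun w => G (nth 0 w 0) (nth 0 w 1) (drop 2 w)) ->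
  rec n.+1 (fun v => iteri (nth 0 v 0) (fun i u => G i u (drop 1 v)) (F (drop 1 v))).
Proof.
move=> [f fF] [g gG]; exists (RPrec f g) => v.
have -> : nth 0 v 0 = thead v by rewrite /thead (tnth_nth 0).
apply: eval_prec; first by have := fF [tuple of behead v]; rewrite /= drop1.
by move=> i u; have := gG [tuple of i :: u :: [tuple of behead v]]; rewrite /= ?drop0 drop1.
Qed.

(** [RPrec] recurses on its first argument; putting a copy of the bound [B v] in front of the whole
    environment lets the step still see all of [v]. *)
Lemma rec_iteri n B F G : rec n B -> rec n F ->
  rec n.+2 (fun w => G (nth 0 w 0) (nth 0 w 1) (drop 2 w)) ->
  rec n (fun v => iteri (B v) (fun i u => G i u v) (F v)).
Proof.
move=> rB rF rG.
apply: rec_ext (rec_env (d := fun v => B v :: v) _ (rec_prec rF rG) _) => [v|v|].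
- by rewrite /= ?drop0.
- by rewrite /= size_tuple.
- exact: proj_cons rB (@proj_id n).
Qed.

Lemma rec_succ n A : rec n A -> rec n (fun v => (A v).+1).
Proof.
apply: (app1 (f := succn)); exists RSucc => v /=.
by rewrite /thead (tnth_nth 0).
Qed.

Lemma rec_const n k : rec n (fun=> k).
Proof. by elim: k => [|k IH]; [exact: rec0|exact: rec_succ]. Qed.

Lemma rec_add n A B : rec n A -> rec n B -> rec n (fun v => A v + B v).
Proof.
move=> rA rB.
apply: rec_ext (rec_iteri (G := fun _ u _ => u.+1) rB rA _) => [v|].
  by elim: (B v) => [|k IH]; rewrite /= ?addn0 // IH addnS.
exact/rec_succ/rec_nth.
Qed.

Lemma rec_weak n a F : rec n F -> rec (a + n) (fun w => F (drop a w)).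
Proof.
move=> rF; apply: (rec_env (m := n)) => //; last exact/proj_drop/proj_id.
by move=> v; rewrite size_drop size_tuple addKn.
Qed.

Lemma rec_mul n A B : rec n A -> rec n B -> rec n (fun v => A v * B v).
Proof.
move=> rA rB.
apply: rec_ext (rec_iteri (G := fun _ u v => u + A v) rB (rec0 _) _) => [v|].
  by elim: (B v) => [|k IH]; rewrite /= ?muln0 // IH mulnS addnC.
by apply: rec_add; [exact: rec_nth|exact: (rec_weak 2 rA)].
Qed.

Lemma rec_pred n A : rec n A -> rec n (fun v => (A v).-1).
Proof.
move=> rA; apply: rec_ext (rec_iteri (G := fun i _ _ => i) rA (rec0 _) _) => [v|].
  by case: (A v).
exact: rec_nth.
Qed.

Lemma rec_sub n A B : rec n A -> rec n B -> rec n (fun v => A v - B v).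
Proof.
move=> rA rB; apply: rec_ext (rec_iteri (G := fun _ u _ => u.-1) rB rA _) => [v|].
  by elim: (B v) => [|k IH]; rewrite /= ?subn0 // IH subnS.
exact/rec_pred/rec_nth.
Qed.

Lemma rec_exp n A B : rec n A -> rec n B -> rec n (fun v => A v ^ B v).
Proof.
move=> rA rB.
apply: rec_ext (rec_iteri (G := fun _ u v => u * A v) rB (rec_const n 1) _) => [v|].
  by elim: (B v) => [|k IH] //=; rewrite IH expnSr.
by apply: rec_mul; [exact: rec_nth|exact: (rec_weak 2 rA)].
Qed.

Definition recb n (p : seq nat -> bool) := rec n (fun v => p v).

Lemma recb_leq n A B : rec n A -> rec n B -> recb n (fun v => A v <= B v).
Proof.
move=> rA rB; apply: rec_ext (rec_sub (rec_const n 1) (rec_sub rA rB)) => v.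
by rewrite -subn_eq0; case: (A v - B v).
Qed.

Lemma recb_neg n p : recb n p -> recb n (fun v => ~~ p v).
Proof.
by move=> rp; apply: rec_ext (rec_sub (rec_const n 1) rp) => v; case: (p v).
Qed.

Lemma recb_and n p q : recb n p -> recb n q -> recb n (fun v => p v && q v).
Proof. by move=> rp rq; apply: rec_ext (rec_mul rp rq) => v; case: (p v) (q v) => -[]. Qed.

Lemma recb_imp n p q : recb n p -> recb n q -> recb n (fun v => p v ==> q v).
Proof.
move=> rp rq; apply: rec_ext (recb_neg (recb_and rp (recb_neg rq))) => v.
by case: (p v) (q v) => -[].
Qed.

Lemma recb_eq n A B : rec n A -> rec n B -> recb n (fun v => A v == B v).
Proof.
move=> rA rB; apply: rec_ext (recb_and (recb_leq rA rB) (recb_leq rB rA)) => v.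
by rewrite eqn_leq.
Qed.

Lemma rec_if n p A B : recb n p -> rec n A -> rec n B ->
  rec n (fun v => if p v then A v else B v).
Proof.
move=> rp rA rB.
apply: rec_ext (rec_add (rec_mul rp rA) (rec_mul (recb_neg rp) rB)) => v.
by case: (p v); rewrite /= ?mul1n ?mul0n ?addn0.
Qed.

(** * Bounded sums, quantifiers and searches *)

Definition bsum n f := iteri n (fun i u => u + f i) 0.

Lemma bsumE n f : bsum n f = \sum_(i < n) f i.
Proof. by elim: n => [|n IH]; rewrite ?big_ord0 // big_ord_recr -IH. Qed.

Lemma rec_inner n F : rec n.+1 (fun w => F (nth 0 w 0) (drop 1 w)) ->
  rec n.+2 (fun w => F (nth 0 w 0) (drop 2 w)).
Proof.
move=> rF; have sz (v : n.+2.-tuple nat) : size (nth 0 v 0 :: drop 2 v) = n.+1.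
  by rewrite /= size_drop size_tuple !subSS subn0.
apply: rec_ext (rec_env (d := fun v => nth 0 v 0 :: drop 2 v) sz rF _) => [v|].
  by rewrite /= drop0.
by apply: proj_cons; [exact: rec_nth|exact/proj_drop/proj_id].
Qed.

Lemma rec_bsum n B F : rec n B -> rec n.+1 (fun w => F (nth 0 w 0) (drop 1 w)) ->
  rec n (fun v => bsum (B v) (fun i => F i v)).
Proof.
move=> rB rF; apply: (rec_iteri (G := fun i u v => u + F i v) rB (rec0 _)).
by apply: rec_add; [exact: rec_nth|exact: rec_inner].
Qed.

Definition bforall n (p : nat -> bool) := bsum n (fun i => ~~ p i) == 0.
Definition bexists n (p : nat -> bool) := ~~ bforall n (fun i => ~~ p i).

Lemma bforallP n (p : nat -> bool) : reflect (forall i, i < n -> p i) (bforall n p).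
Proof.
rewrite /bforall bsumE; apply: (iffP eqP) => [/eqP|] h.
  move=> i ni; move: h; rewrite sum_nat_eq0 => /forallP /(_ (Ordinal ni)) /=.
  by case: (p i).
by apply: big1 => i _; rewrite h.
Qed.

Lemma bexistsP n (p : nat -> bool) : reflect (exists2 i, i < n & p i) (bexists n p).
Proof.
apply: (iffP negP) => [h|[i ni pi] /bforallP/(_ _ ni)]; last by rewrite pi.
apply: contrapT => h'; apply: h; apply/bforallP => i ni; apply/negP => pi.
by apply: h'; exists i.
Qed.

Lemma recb_bforall n B (p : nat -> seq nat -> bool) :
  rec n B -> recb n.+1 (fun w => p (nth 0 w 0) (drop 1 w)) ->
  recb n (fun v => bforall (B v) (fun i => p i v)).
Proof.
move=> rB rp; apply: recb_eq (rec0 _).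
exact: (rec_bsum (F := fun i v => ~~ p i v) rB (recb_neg rp)).
Qed.

Lemma recb_bexists n B (p : nat -> seq nat -> bool) :
  rec n B -> recb n.+1 (fun w => p (nth 0 w 0) (drop 1 w)) ->
  recb n (fun v => bexists (B v) (fun i => p i v)).
Proof.
move=> rB rp; apply: recb_neg.
exact: (recb_bforall (p := fun i v => ~~ p i v) rB (recb_neg rp)).
Qed.

(* The least [i < T] with [p i], and [T] if there is none. *)
Definition minb T (p : nat -> bool) :=
  iteri T (fun i u => if (u == i) && ~~ p i then i.+1 else u) 0.

Lemma minb_spec T (p : nat -> bool) : [/\ minb T p <= T, minb T p < T -> p (minb T p) &
  forall i, i < minb T p -> ~~ p i].
Proof.
elim: T => [|T [IH1 IH2 IH3]] //=; rewrite -/(minb T p).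
case: eqP IH1 IH2 IH3 => [->|ne] IH1 IH2 IH3 /=; last first.
  have lt : minb T p < T by rewrite ltn_neqAle IH1 andbT; apply/eqP.
  by split=> //; [exact: leqW|move=> _; exact: IH2].
case: (boolP (p T)) => pT /=; first by split.
split=> //; first by rewrite ltnn.
by move=> i; rewrite ltnS leq_eqVlt => /orP[/eqP->//|/IH3].
Qed.

Lemma minb_eq T (p : nat -> bool) z :
  z < T -> p z -> (forall i, i < z -> ~~ p i) -> minb T p = z.
Proof.
move=> zT pz hz; have [h1 h2 h3] := minb_spec T p.
case: (ltngtP (minb T p) z) => // h.
  by have := hz _ h; rewrite h2 // (ltn_trans h).
by have := h3 _ h; rewrite pz.
Qed.

Lemma minb_lt T (p : nat -> bool) z : z < T -> p z -> minb T p < T.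
Proof.
move=> zT pz; have [h1 h2 h3] := minb_spec T p.
by rewrite ltnNge; apply/negP => h; have := h3 _ (leq_trans zT h); rewrite pz.
Qed.

Lemma rec_minb n B (p : nat -> seq nat -> bool) :
  rec n B -> recb n.+1 (fun w => p (nth 0 w 0) (drop 1 w)) ->
  rec n (fun v => minb (B v) (fun i => p i v)).
Proof.
move=> rB rp.
apply: (rec_iteri (G := fun i u v => if (u == i) && ~~ p i v then i.+1 else u) rB (rec0 _)).
apply: rec_if; last exact: rec_nth.
  apply: recb_and; first by apply: recb_eq; exact: rec_nth.
  exact/recb_neg/(rec_inner (F := fun i v => p i v)).
exact/rec_succ/rec_nth.
Qed.

(** The quotient is the least [i] with [A < (i + 1) * B]. It is at most [A], so a failed search,
    which returns [A], is correct too; division by zero is set to 0 separately. *)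
Lemma rec_divn n A B : rec n A -> rec n B -> rec n (fun v => A v %/ B v).
Proof.
move=> rA rB.
apply: rec_ext (rec_if (recb_eq rB (rec0 _)) (rec0 _)
  (rec_minb (B := A) (p := fun i v => A v < i.+1 * B v) rA _)) => [v|].
  case: eqP => [->|/eqP]; first by rewrite divn0.
  rewrite -lt0n => B0.
  have [h1 h2 h3] := minb_spec (A v) (fun i => A v < i.+1 * B v).
  set q := minb _ _ in h1 h2 h3 *; apply/eqP; rewrite eqn_leq; apply/andP; split.
    case: q h3 {h1 h2} => // q /(_ q (ltnSn _)); rewrite -leqNgt => h.
    by rewrite leq_divRL.
  case: (ltnP q (A v)) => [/h2 h|h]; first by rewrite -ltnS ltn_divLR.
  by apply: leq_trans h; exact: leq_div.
apply: recb_leq.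
  by apply: rec_succ; exact: (rec_weak 1 rA).
by apply: rec_mul; [exact/rec_succ/rec_nth|exact: (rec_weak 1 rB)].
Qed.

Lemma rec_odd n A : rec n A -> recb n (fun v => odd (A v)).
Proof.
have r2 := rec_const n 2; move=> rA.
apply: rec_ext (rec_sub rA (rec_mul (rec_divn rA r2) r2)) => v.
by rewrite -modn2 {1}(divn_eq (A v) 2) addKn.
Qed.

Lemma rec_log2 n A : rec n A -> rec n (fun v => trunc_log 2 (A v)).
Proof.
move=> rA.
apply: rec_ext (rec_minb (B := A) (p := fun i v => A v < 2 ^ i.+1) rA _) => [v|].
  case: (posnP (A v)) => [->|A0]; first by [].
  apply: minb_eq; first exact: leq_trans (ltn_expl _ _) (trunc_logP _ A0).
    exact: trunc_log_ltn.
  move=> i; rewrite -leqNgt => h; apply: leq_trans (trunc_logP (isT : 1 < 2) A0).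
  by rewrite leq_exp2l.
apply: recb_leq; first by apply: rec_succ; exact: (rec_weak 1 rA).
by apply: rec_exp; [exact: rec_const|exact/rec_succ/rec_nth].
Qed.

(** * Step-bounded evaluation *)

Lemma recb_big_and n m (p : 'I_m -> seq nat -> bool) :
  (forall i, recb n (p i)) -> recb n (fun v => [forall i, p i v]).
Proof.
move=> rp.
apply: rec_ext (_ : rec n (fun v => \prod_(i < m) p i v)) => [v|].
  case: forallP => [h|/forallP/forallPn[i /negbTE pi]].
    by rewrite big1 // => i _; rewrite h.
  by rewrite (bigD1 i) //= pi.
elim: m p rp => [|m IH] p rp.
  by apply: rec_ext (rec_const n 1) => v; rewrite big_ord0.
apply: rec_ext (rec_mul (IH (fun i => p (lift ord0 i)) _) (rp ord0)) => [v|i //].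
by rewrite big_ord_recl mulnC.
Qed.

(* [S s v] is [z.+1] once the computation is seen to halt with value [z], and
   [0] before; [s] bounds the unbounded searches. *)
Definition clocked n (c : recf n) (S : nat -> seq nat -> nat) :=
  [/\ rec n.+1 (fun w => S (nth 0 w 0) (drop 1 w)),
      forall s (v : n.-tuple nat) z, S s v = z.+1 -> eval c v z &
      forall (v : n.-tuple nat) z, eval c v z ->
        exists s0, forall s, s0 <= s -> S s v = z.+1].

Lemma common_bound m (P : 'I_m -> nat -> Prop) :
  (forall i, exists s0, forall s, s0 <= s -> P i s) ->
  exists s0, forall s i, s0 <= s -> P i s.
Proof.
move=> /choice[g gP]; exists (\max_i g i) => s i hs; apply: gP.
exact: leq_trans (leq_bigmax i) hs.
Qed.

Lemma clocked_comp m n (f : recf m) (g : 'I_m -> recf n) Sf Sg :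
  clocked f Sf -> (forall i, clocked (g i) (Sg i)) ->
  clocked (RComp f g) (fun s v => if [forall i, Sg i s v != 0]
    then Sf s [seq (Sg i s v).-1 | i <- enum 'I_m] else 0).
Proof.
move=> [rf sf cf] hg; split.
- have rg i : rec n.+1 (fun w => Sg i (nth 0 w 0) (drop 1 w)) by case: (hg i).
  apply: rec_if; last exact: rec0.
    apply: recb_big_and => i; apply: recb_neg; apply: recb_eq (rg i) (rec0 _).
  apply: rec_ext (rec_env (d := fun w => nth 0 w 0 ::
    [seq (Sg i (nth 0 w 0) (drop 1 w)).-1 | i <- enum 'I_m]) _ rf _).
  + by move=> w /=; rewrite ?drop0.
  + by move=> w; rewrite /= size_map size_enum_ord.
  + apply: proj_cons; first exact: rec_nth.
    move=> k; case: (ltnP k m) => km.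
      apply: rec_ext (rec_pred (rg (Ordinal km))) => w.
      by rewrite (nth_map_enum _ (Ordinal km)).
    by apply: rec_ext (rec0 _) => w; rewrite nth_default // size_map size_enum_ord.
- move=> s v z; case: forallP => // h.
  move=> /(sf s [tuple (Sg i s v).-1 | i < m]) hz.
  exists [tuple (Sg i s v).-1 | i < m]; split=> // i; rewrite tnth_mktuple.
  have [_ sg _] := hg i; apply: (sg s).
  by rewrite prednK // lt0n.
- move=> v z [w [hw /cf[s0 hs0]]].
  have [|s1 hs1] := @common_bound m (fun i s => Sg i s v = (tnth w i).+1).
    by move=> i; have [_ _ cg] := hg i; exact: cg (hw i).
  exists (maxn s0 s1) => s; rewrite geq_max => /andP[h0 h1].
  case: forallP => [_|[]]; last by move=> i; rewrite hs1.
  rewrite -(hs0 s h0); congr Sf; rewrite -[RHS]map_tnth_enum.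
  by apply: eq_map => i; rewrite hs1.
Qed.

Definition prec_rel n (f : recf n) (g : recf n.+2) (w : n.-tuple nat) :=
  fix prec (k : nat) : nat -> Prop :=
    match k with
    | 0 => eval f w
    | i.+1 => fun z => exists u, prec i u /\ eval g [tuple of i :: u :: w] z
    end.

Lemma eval_precE n (f : recf n) (g : recf n.+2) (w : n.-tuple nat) k :
  eval (RPrec f g) [tuple of k :: w] = prec_rel f g w k.
Proof.
rewrite -[LHS]/(prec_rel f g [tuple of behead [tuple of k :: w]] (thead [tuple of k :: w])).
by rewrite theadE; congr (prec_rel f g _ k); exact: val_inj.
Qed.

(** A clocked value 0 (no result yet) is passed on through the iteration; a positive value is the
    result plus one, whence the predecessor. *)
Lemma clocked_prec n (f : recf n) (g : recf n.+2) Sf Sg :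
  clocked f Sf -> clocked g Sg ->
  clocked (RPrec f g) (fun s v => iteri (nth 0 v 0)
    (fun i u => if u == 0 then 0 else Sg s [:: i, u.-1 & drop 1 v])
    (Sf s (drop 1 v))).
Proof.
move=> [rf sf cf] [rg sg cg]; split.
- apply: (rec_iteri (n := n.+2) (B := fun w => nth 0 (drop 1 w) 0)
    (F := fun w => Sf (nth 0 w 0) (drop 1 (drop 1 w)))
    (G := fun i u w => if u == 0 then 0 else
      Sg (nth 0 w 0) [:: i, u.-1 & drop 1 (drop 1 w)])).
  + exact/proj_drop/proj_id.
  + apply: rec_ext (rec_env (d := fun w => nth 0 w 0 :: drop 1 (drop 1 w)) _ rf _).
    * by move=> w /=; rewrite ?drop0.
    * by move=> w /=; rewrite drop_drop size_drop size_tuple !subSS subn0.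
    * by apply: proj_cons; [exact: rec_nth|exact/proj_drop/proj_drop/proj_id].
  + apply: rec_if; [|exact: rec0|].
      by apply: recb_eq; [exact: rec_nth|exact: rec0].
    apply: rec_ext (rec_env (d := fun w => [:: nth 0 (drop 2 w) 0,
      nth 0 w 0, (nth 0 w 1).-1 & drop 1 (drop 1 (drop 2 w))]) _ rg _).
    * by move=> w /=; rewrite ?drop0.
    * by move=> w /=; rewrite !drop_drop size_drop size_tuple !subSS subn0.
    * apply: proj_cons; first exact/proj_drop/proj_id.
      apply: proj_cons; first exact: rec_nth.
      apply: proj_cons; first exact/rec_pred/rec_nth.
      exact/proj_drop/proj_drop/proj_drop/proj_id.
- move=> s v; case/tupleP: v => k w z; rewrite eval_precE /= drop0.
  elim: k z => [|k IH] z; first exact: sf.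
  rewrite /=; case: eqP => // /eqP; rewrite -lt0n => h0.
  move=> /(sg s [tuple of [:: k, _ & w]]) h.
  eexists; split; last exact: h.
  by apply: IH; rewrite prednK.
- move=> v; case/tupleP: v => k w z; rewrite eval_precE /= drop0.
  elim: k z => [|k IH] z; first exact: cf.
  move=> [u [/IH[s0 h0] /cg[s1 h1]]].
  exists (maxn s0 s1) => s; rewrite geq_max => /andP[l0 l1] /=.
  by rewrite h0 //= -(h1 s).
Qed.

(** The search stops at the first [i] whose clocked value is 0 (not halted yet) or 1 (halted with
    value 0), and only the latter is a success. Earlier values are at least 2, which certifies that
    they are defined and nonzero. *)
Lemma clocked_mu n (f : recf n.+1) Sf : clocked f Sf ->
  clocked (RMu f) (fun s v =>
    if Sf s (minb s (fun i => Sf s (i :: v) <= 1) :: v) == 1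
    then (minb s (fun i => Sf s (i :: v) <= 1)).+1 else 0).
Proof.
move=> [rf sf cf]; split.
- have rm : rec n.+1 (fun w => minb (nth 0 w 0)
      (fun i => Sf (nth 0 w 0) (i :: drop 1 w) <= 1)).
    apply: (rec_minb (p := fun i w => Sf (nth 0 w 0) (i :: drop 1 w) <= 1)).
      exact: rec_nth.
    apply: recb_leq; last exact: rec_const.
    apply: rec_ext (rec_env (d := fun w =>
      [:: nth 0 (drop 1 w) 0, nth 0 w 0 & drop 1 (drop 1 w)]) _ rf _).
    + by move=> w /=; rewrite ?drop0.
    + by move=> w /=; rewrite drop_drop size_drop size_tuple !subSS subn0.
    + apply: proj_cons; first exact/proj_drop/proj_id.
      apply: proj_cons; first exact: rec_nth.
      exact/proj_drop/proj_drop/proj_id.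
  apply: rec_if; [|exact: rec_succ|exact: rec0].
  apply: recb_eq; last exact: rec_const.
  apply: rec_ext (rec_env (d := fun w => [:: nth 0 w 0,
    minb (nth 0 w 0) (fun i => Sf (nth 0 w 0) (i :: drop 1 w) <= 1) & drop 1 w]) _ rf _).
  + by move=> w /=; rewrite ?drop0.
  + by move=> w /=; rewrite size_drop size_tuple !subSS subn0.
  + apply: proj_cons; first exact: rec_nth.
    apply: proj_cons; first exact: rm.
    exact/proj_drop/proj_id.
- move=> s v z; case: eqP => // h1 [<-]; set k := minb _ _ in h1 *.
  have [_ _ hk] := minb_spec s (fun i => Sf s (i :: v) <= 1).
  split; first exact: (sf s [tuple of k :: v]).
  move=> i /hk; rewrite -ltnNge => hi.
  exists (Sf s (i :: v)).-2; apply: (sf s [tuple of i :: v]) => /=.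
  by case: (Sf s _) hi => [|[]].
- move=> v z [/cf[s0 h0] hi].
  have /choice[u hu] : forall i : 'I_z, exists u, eval f [tuple of val i :: v] u.+1.
    by move=> i; have := hi i (ltn_ord i).
  have [|s1 h1] := @common_bound z (fun i s => Sf s (val i :: v) = (u i).+2).
    by move=> i; have /cf := hu i.
  exists (maxn z.+1 (maxn s0 s1)) => s; rewrite !geq_max => /and3P[lz l0 l1].
  have -> : minb s (fun i => Sf s (i :: v) <= 1) = z.
    apply: minb_eq => //; first by rewrite (h0 s l0).
    by move=> i iz; rewrite (h1 s (Ordinal iz)).
  by rewrite (h0 s l0).
Qed.

Lemma clockedP n (c : recf n) : exists S, clocked c S.
Proof.
elim: c => {n}.
- move=> n; exists (fun _ _ => 1); split; first exact: rec_const.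
    by move=> s v z [<-].
  by move=> v z ->; exists 0.
- exists (fun _ v => (nth 0 v 0).+2); split.
  + by apply/rec_succ/rec_succ/proj_drop/proj_id.
  + by move=> s v z [<-]; rewrite /= /thead (tnth_nth 0).
  + by move=> v z /= ->; exists 0 => s _; rewrite /thead (tnth_nth 0).
- move=> n i; exists (fun _ v => (nth 0 v i).+1); split.
  + by apply/rec_succ/proj_drop/proj_id.
  + by move=> s v z [<-]; rewrite /= (tnth_nth 0).
  + by move=> v z /= ->; exists 0 => s _; rewrite (tnth_nth 0).
- move=> m n f [Sf hf] g /choice[Sg hg]; eexists; exact: clocked_comp hf hg.
- by move=> n f [Sf hf] g [Sg hg]; eexists; exact: clocked_prec hf hg.
- by move=> n f [Sf hf]; eexists; exact: clocked_mu hf.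
Qed.

(** Determinism comes from the clock: at a late enough stage one number records both values. *)
Lemma eval_fun n (c : recf n) v z z' : eval c v z -> eval c v z' -> z = z'.
Proof.
have [S [_ _ cS]] := clockedP c => /cS[s hs] /cS[s' hs'].
by have := hs' (maxn s s') (leq_maxr _ _); rewrite hs ?leq_maxl // => -[].
Qed.

(** Serves to build machines that wait for a decidable event before answering. As [RMu] looks for a
    zero, it is applied to the negation of [p]. *)
Lemma mu_out (p : nat -> nat -> bool) (o : nat -> nat -> nat) :
  rec2 (fun T n => p T n) -> rec2 o ->
  exists c : recf 1, forall n z,
    eval c [tuple n] z <->
    exists T, [/\ p T n, forall i, i < T -> ~~ p i n & z = o T n].
Proof.
move=> /(recb_neg (n := 2) (p := fun v => p (nth 0 v 0) (nth 0 v 1)))[cp hp] [co ho].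
have hp' i n : eval cp [tuple of i :: [tuple n]] (~~ p i n).
  exact: (hp [tuple of i :: [tuple n]]).
exists (RComp co (fun i : 'I_2 => if val i is 0 then RMu cp else RProj ord0)) => n z /=.
split.
- move=> [w [hw hz]].
  have [h1 h2] := hw ord0; have /= h3 := hw (lift ord0 ord0).
  exists (tnth w ord0); split.
  + by have := eval_fun (hp' (tnth w ord0) n) h1; case: (p _ _).
  + by move=> i /h2[u] /(eval_fun (hp' i n)); case: (p _ _).
  + apply: (eval_fun hz); have := ho w.
    rewrite -[nth 0 w 0]/(nth 0 w (@ord0 1)) -tnth_nth.
    by rewrite -[nth 0 w 1]/(nth 0 w (lift (@ord0 1) ord0)) -tnth_nth h3.
- move=> [T [pT hT ->]]; exists [tuple T; n]; split; last exact: (ho [tuple T; n]).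
  case=> -[|[|//]] ?; last by rewrite /= !(tnth_nth 0).
  rewrite (tnth_nth 0) /=; split; first by have := hp' T n; rewrite pT.
  by move=> i iT; exists 0; have := hp' i n; rewrite (hT i iT).
Qed.

Lemma mu_total (p : nat -> nat -> bool) : rec2 (fun T n => p T n) ->
  (forall n, exists T, p T n) -> exists2 f, rec1 f & forall n, p (f n) n.
Proof.
move=> rp hp; have [c hc] := mu_out (o := fun T _ => T) rp (rec_nth 2 0).
exists (fun n => ex_minn (hp n)); last by move=> n; case: ex_minnP.
exists c => v; case/tupleP: v => a w; rewrite (tuple0 w) /=.
rewrite hc; case: ex_minnP => T pT hT; exists T; split=> // i iT.
by apply/negP => /hT; rewrite leqNgt iT.
Qed.

(** * Finite approximations to the family of pairs *)

Lemma rec_drop n a d k : rec n (fun v => nth 0 (d v) (a + k)) ->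
  rec n (fun v => nth 0 (drop a (d v)) k).
Proof. by apply: rec_ext => v; rewrite nth_drop. Qed.

(** Recursiveness follows the shape of the term. Hypotheses [rec1] to [rec4] in the context act as
    further primitives, so auxiliary functions are brought in by [have] before the call. *)
Ltac rec_step := first
  [ assumption
  | apply: rec_const | apply: rec_nth | apply: rec_drop
  | apply: recb_bforall | apply: recb_bexists | apply: rec_odd
  | apply: recb_imp | apply: recb_and | apply: recb_neg
  | apply: recb_leq | apply: recb_eq
  | apply: rec_succ | apply: rec_pred | apply: rec_add | apply: rec_sub
  | apply: rec_mul | apply: rec_exp | apply: rec_divn | apply: rec_log2
  | apply: rec_if | apply: rec_bsum | apply: rec_minb | apply: rec_iteri
  | match goal with H : rec1 _ |- _ => apply: (app1 H) end
  | match goal with H : rec2 _ |- _ => apply: (app2 H) end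
  | match goal with H : rec3 _ |- _ => apply: (app3 H) end
  | match goal with H : rec4 _ |- _ => apply: (app4 H) end ].
Ltac rec_tac := rewrite ?/rec1 ?/rec2 ?/rec3 ?/rec4; repeat rec_step.

Section Pairs.
Variables f g : nat -> nat -> nat.
Hypotheses (rf : rec2 f) (rg : rec2 g).

(** One number [K] is both the bound on the indices inspected and the stage of the
    approximations. *)
Definition pairb K x y := bexists K (fun n => (f n K == x) && (g n K == y)).

Lemma rec_pairb : rec3 (fun K x y => pairb K x y).
Proof. rewrite /pairb; rec_tac. Qed.

(** This is [2 ^ (x - y)] scaled by [2 ^ K], an integer for [y < K]. *)
Definition pairw K x y := if (x <= y) && pairb K x y then 2 ^ (K + x - y) else 0.

Definition wsum c K := bsum K (fun x => bsum K (fun y =>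
  if c < x then pairw K x y else 0)).

Lemma rec_wsum : rec2 wsum.
Proof. have rp := rec_pairb; rewrite /wsum /pairw; rec_tac. Qed.

(* The sum of 2^(x-y) over the approximate pairs with [2 * c < x] is at least
   2^(4c+8): more than the 2^(3c+3) that defeats [m] and the 2^(2c+3) that defeats
   a prefix-free decompressor. *)
Definition rich K c := 2 ^ (K + 4 * c + 8) <= wsum (2 * c) K.

Lemma rec_rich : rec2 (fun K c => rich K c).
Proof. have rw := rec_wsum; rewrite /rich; rec_tac. Qed.
End Pairs.

(** * Sums of distinct powers of two, and existence of rich stages *)

Lemma sum_exp2_lt n : \sum_(i < n) 2 ^ i < 2 ^ n.
Proof.
elim: n => [|n IH]; first by rewrite big_ord0.
by rewrite big_ord_recr /= expnS mul2n -addnn ltn_add2r.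
Qed.

Lemma sum_exp2_rev_lt n : \sum_(i < n) 2 ^ (n - i) < 2 ^ n.+1.
Proof.
rewrite (reindex_inj rev_ord_inj) /=.
under eq_bigr => i _ do rewrite subKn // expnS.
by rewrite -big_distrr /= expnS ltn_mul2l sum_exp2_lt.
Qed.

(** Distinct powers of two add up to less than twice the largest one, here at the least [y] in [Q];
    the induction looks for that [y]. *)
Lemma sum_low_exp2 K (Q : pred nat) a :
  (forall y, y < K -> Q y -> 2 ^ (K - y) <= a) ->
  \sum_(y < K | Q y) 2 ^ (K - y) <= 2 * a.
Proof.
elim: K Q a => [|K IH] Q a h; first by rewrite big_ord0.
case: (boolP (Q 0)) => Q0.
  apply: (@leq_trans (\sum_(i < K.+1) 2 ^ (K.+1 - i))).
    by rewrite [X in _ <= X](bigID (fun i => Q (val i))) /= leq_addr.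
  apply: leq_trans (ltnW (sum_exp2_rev_lt _)) _.
  by rewrite expnS leq_mul2l /=; have := h 0 isT Q0; rewrite subn0.
rewrite big_mkcond big_ord_recl /= (negbTE Q0) add0n.
rewrite -big_mkcond /=; apply: (IH (fun y => Q y.+1)) => y yK Qy.
by have := h y.+1 yK Qy; rewrite subSS.
Qed.

Lemma sum_high_exp2 K (Q : pred nat) a :
  (forall x, x < K -> Q x -> 2 ^ x <= a) ->
  \sum_(x < K | Q x) 2 ^ x <= 2 * a.
Proof.
elim: K Q a => [|K IH] Q a h; first by rewrite big_ord0.
case: (boolP (Q K)) => QK.
  apply: (@leq_trans (\sum_(i < K.+1) 2 ^ i)).
    by rewrite [X in _ <= X](bigID (fun i => Q (val i))) /= leq_addr.
  apply: leq_trans (ltnW (sum_exp2_lt _)) _.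
  by rewrite expnS leq_mul2l /= h.
rewrite big_mkcond big_ord_recr /= (negbTE QK) addn0 -big_mkcond /=.
by apply: IH => x xK; apply: h; rewrite ltnS ltnW.
Qed.

(** Distinctness of the pairs enters here: the sequence visits each cell of the grid at most
    once. *)
Lemma sum_inj_pairs (x y : nat -> nat) M K (h : nat -> nat -> nat) :
  injective (fun n => (x n, y n)) ->
  (forall n, n < M -> h (x n) (y n) != 0 -> x n < K /\ y n < K) ->
  \sum_(n < M) h (x n) (y n) <= \sum_(a < K) \sum_(b < K) h a b.
Proof.
move=> inj lt.
rewrite -(big_mkord xpredT (fun n => h (x n) (y n))).
rewrite (bigID (fun n => h (x n) (y n) == 0)) /=.
rewrite [X in X + _]big1 ?add0n; last by move=> n /eqP.
rewrite -big_filter -(big_map (fun n => (x n, y n)) xpredT (fun p => h p.1 p.2)).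
under [X in _ <= X]eq_bigr => a _ do rewrite -(big_mkord xpredT (fun b => h a b)).
rewrite -(big_mkord xpredT (fun a => \sum_(0 <= b < K) h a b)).
rewrite -(big_allpairs (F := fun p => h p.1 p.2)).
apply: (uniq_sub_le_big (op := addn) leqnn) => [a b||| p].
- exact: leq_addr.
- by rewrite map_inj_uniq // filter_uniq // iota_uniq.
- by apply: allpairs_uniq; rewrite ?iota_uniq // => -[a b] [a' b'].
- case/mapP => n; rewrite mem_filter mem_index_iota => /andP[hn nM] ->.
  by have [xK yK] := lt n nM hn; apply: allpairs_f; rewrite mem_index_iota.
Qed.

Lemma eventually_common M (P : nat -> nat -> Prop) :
  (forall n, exists k0, forall k, k0 <= k -> P n k) ->
  exists k0, forall k n, k0 <= k -> n < M -> P n k.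
Proof.
move=> h; have [|k0 hk] := @common_bound M (fun i k => P i k); first by move=> i; exact: h.
by exists k0 => k n kk nM; exact: (hk k (Ordinal nM)).
Qed.

(** The pairs with [x <= 2 * c] have a bounded sum, since the factors [2 ^ x] and [2 ^ (- y)] can be
    summed separately. Removing them from a divergent sum leaves arbitrarily large finite sums,
    which a late stage sees exactly. *)
Lemma rich_exists f g (x y : nat -> nat) c :
  injective (fun n => (x n, y n)) -> (forall n, x n <= y n) ->
  (forall n, exists k0, forall k, k0 <= k -> f n k = x n) ->
  (forall n, exists k0, forall k, k0 <= k -> g n k = y n) ->
  (forall A, exists M, forall K, (forall n, n < M -> y n <= K) ->
     A * 2 ^ K <= \sum_(n < M) 2 ^ (K + x n - y n)) ->
  exists K, rich f g K c.
Proof.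
move=> inj xy hf hg hA.
(* The first summand is the richness wanted, the second pays for the pairs with [x <= 2 * c]. *)
have [M hM] := hA (2 ^ (4 * c + 8) + 2 ^ (2 * c + 1) * 2).
have [k1 h1] := eventually_common M hf.
have [k2 h2] := eventually_common M hg.
have [k3 h3] := @eventually_common M (fun n k => y n < k)
  (fun n => ex_intro _ (y n).+1 (fun k => id)).
(* From this stage on the first [M] indices are inspected, both approximations are exact on them,
   and their [y n] lie below [K]. *)
exists (maxn M (maxn k1 (maxn k2 k3))); set K := maxn _ _.
have [KM K1 K2 K3] : [/\ M <= K, k1 <= K, k2 <= K & k3 <= K].
  by rewrite /K !leq_max !leqnn !orbT.
have yK n : n < M -> y n < K by exact: h3.
have {hM} := hM K (fun n nM => ltnW (yK n nM)).
rewrite (bigID (fun n : 'I_M => x n <= 2 * c)) /=.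
set lo := \sum_(n < M | x n <= _) _; set hi := \sum_(n < M | ~~ _) _ => tot.
have lo_le : lo <= 2 ^ (2 * c + 1) * 2 * 2 ^ K.
  pose h a b := if a <= 2 * c then 2 ^ (K - b) * 2 ^ a else 0.
  have -> : lo = \sum_(n < M) h (x n) (y n).
    rewrite /lo big_mkcond; apply: eq_bigr => n _; rewrite /h.
    by case: ifP => // _; rewrite -expnD; congr expn; have := yK n (ltn_ord n); lia.
  have h0 n : n < M -> h (x n) (y n) != 0 -> x n < K /\ y n < K.
    by move=> nM _; have := yK n nM; have := xy n; lia.
  apply: leq_trans (sum_inj_pairs inj h0) _.
  apply: (@leq_trans (\sum_(a < K | a <= 2 * c) 2 ^ a * 2 ^ K.+1)).
    rewrite [X in _ <= X]big_mkcond /=; apply: leq_sum => a _; rewrite /h.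
    case: ifP => // _; last by rewrite big1.
    rewrite -big_distrl /= mulnC leq_mul2l; apply/orP; right.
    exact/ltnW/sum_exp2_rev_lt.
  rewrite -big_distrl /= expnS mulnA leq_mul2r; apply/orP; right.
  rewrite leq_mul2r /=.
  apply: leq_trans (sum_high_exp2 (Q := fun a => a <= 2 * c) (a := 2 ^ (2 * c)) _) _.
    by move=> a _ ?; rewrite leq_exp2l.
  by rewrite addn1 expnS.
have hi_le : hi <= wsum f g (2 * c) K.
  pose h a b := if 2 * c < a then pairw f g K a b else 0.
  have -> : hi = \sum_(n < M) h (x n) (y n).
    rewrite /hi big_mkcond; apply: eq_bigr => n _; rewrite /h -ltnNge.
    case: ifP => // _; rewrite /pairw xy /=.
    suff -> : pairb f g K (x n) (y n) by [].
    apply/bexistsP; exists (val n); first exact: leq_trans (ltn_ord n) KM.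
    by rewrite (h1 K n K1) // (h2 K n K2) // !eqxx.
  rewrite /wsum bsumE; under [X in _ <= X]eq_bigr => a _ do rewrite bsumE.
  apply: (sum_inj_pairs (h := h) inj) => n nM _.
  by have := yK n nM; have := xy n; lia.
rewrite /rich -addnA expnD mulnC.
move: tot lo_le hi_le; rewrite mulnDl.
move: (2 ^ (4 * c + 8) * 2 ^ K) (2 ^ (2 * c + 1) * 2 * 2 ^ K).
by clear; move: lo hi (wsum f g (2 * c) K) => *; lia.
Qed.

(** * Strings, complexity, and the game against the a priori probability *)

(** The codes of the strings of length [l] fill the interval from [2 ^ l - 1] to [2 ^ l.+1 - 2], so
    a logarithm recovers the length. *)
Lemma string_code_bounds p :
  2 ^ size p <= (string_code p).+1 < 2 ^ (size p).+1.
Proof.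
elim: p => // b p /andP[h1 h2]; rewrite /= [2 ^ (size p).+2]expnS.
by move: h1 h2; rewrite !expnS; move: (2 ^ size p) => a; case: b; lia.
Qed.

Lemma size_string_code p : size p = trunc_log 2 (string_code p).+1.
Proof. by apply/esym/trunc_log_eq => //; exact: string_code_bounds. Qed.

Lemma string_code_surj n : exists p, string_code p = n.
Proof.
elim/ltn_ind: n => -[|n] IH; first by exists [::].
have [p hp] := IH n./2 ltac:(lia).
by exists (odd n :: p); rewrite /= hp; lia.
Qed.

Lemma decompressor_of_recf (c : recf 1) : exists E : seq bool -> option nat,
  forall p N, E p = Some N <-> eval c [tuple string_code p] N.
Proof.
have /choice[E hE] : forall p, exists o : option nat, forall N,
    o = Some N <-> eval c [tuple string_code p] N.
  move=> p; case: (pselect (exists N, eval c [tuple string_code p] N)) => [[N hN]|h].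
    by exists (Some N) => N'; split=> [[<-]//|/(eval_fun hN)->].
  by exists None => N; split=> // hN; case: h; exists N.
by exists E.
Qed.

(** Built by first letter, to match the induction in Kraft's inequality. *)
Fixpoint strings_upto y : seq (seq bool) :=
  [::] :: if y is y'.+1 then [seq false :: p | p <- strings_upto y'] ++
                             [seq true :: p | p <- strings_upto y'] else [::].

Lemma mem_strings_upto y p : (p \in strings_upto y) = (size p <= y).
Proof.
elim: y p => [|y IH] [|b p] //; rewrite [strings_upto _]/= inE mem_cat /= ltnS.
rewrite -IH; apply/orP/idP => [[]/mapP[q hq [_ ->]] //|hp].
by case: b; [right|left]; apply: map_f.
Qed.

Lemma complexity_leP D N n :
  complexity_le D N n <-> exists2 p, size p <= n & D p = Some N.
Proof.
split=> [[k [[[p hp <-] _] kn]]|[p pn hp]]; first by exists p.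
pose A k := `[< exists2 q, D q = Some N & size q = k >].
have exA : exists k, A k by exists (size p); apply/asboolP; exists p.
case: (ex_minnP exA) => k /asboolP[q hq sq] hk; exists k; split.
  split; first by exists q.
  by move=> l [r hr rl]; apply: hk; apply/asboolP; exists r.
by apply: leq_trans pn; apply: hk; apply/asboolP; exists p.
Qed.

(** Only finitely many programs have length at most [n]; the given program [p] makes the set of
    their outputs nonempty. *)
Lemma is_B_exists D p N n : size p <= n -> D p = Some N ->
  exists2 b, is_B D n b & N <= b.
Proof.
move=> pn hp; pose A N := `[< complexity_le D N n >].
have exA : exists N, A N by exists N; apply/asboolP/complexity_leP; exists p.
have ubA M : A M -> M <= \max_(q <- strings_upto n) odflt 0 (D q).
  move=> /asboolP/complexity_leP[q qn hq].
  have -> : M = odflt 0 (D q) by rewrite hq.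
  by apply: (leq_bigmax_seq (F := fun q => odflt 0 (D q))) => //; rewrite mem_strings_upto.
case: (ex_maxnP exA ubA) => b /asboolP hb hmax; exists b.
  by split=> // l hl; apply: hmax; apply/asboolP.
by apply: hmax; apply/asboolP/complexity_leP; exists p.
Qed.

Lemma not_worseP D E : not_worse D E -> exists c, forall p N, E p = Some N ->
  exists2 q, size q <= size p + c & D q = Some N.
Proof.
move=> [c hc]; exists c => p N hp.
have /complexity_leP[] : complexity_le E N (size p) by apply/complexity_leP; exists p.
have [k [hk kp]] : complexity_le E N (size p) by apply/complexity_leP; exists p.
have /complexity_leP[q hq hN] := hc _ _ hk => _ _ _; exists q => //.
by apply: leq_trans hq _; rewrite leq_add2r.
Qed.

(** * The game for (i): descriptions of growing numbers *)

Section Game1.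
Variables (f g d : nat -> nat -> nat) (Kf : nat -> nat).
Hypotheses (rf : rec2 f) (rg : rec2 g) (rd : rec2 d) (rK : rec1 Kf).

(** Level [e] is the block of the [2 ^ e] turns from [2 ^ e - 1] to [2 ^ e.+1 - 2]; it serves the
    pairs with [x = e + 2 * c + 1]. *)
Definition level t := trunc_log 2 t.+1.

(* [d k N / 2 ^ N] will be a lower bound for [m k]. *)
Definition heavy c t N v := bforall (Kf c) (fun y =>
  pairb f g (Kf c) (level t + 2 * c + 1) y ==>
  (2 ^ N <= 2 ^ y.+1 * bsum N (fun k => if v <= k then d k N else 0))).

Lemma rec_heavy : rec4 (fun c t N v => heavy c t N v).
Proof. have rp := rec_pairb rf rg; rewrite /heavy /level; rec_tac. Qed.

(* All searches are cut off at [T]: a value below [T] is the true one, and [T]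
   means that the game is still waiting. *)
Definition game c T t :=
  iteri t (fun i v => minb T (fun N => (v < N) && heavy c i N v)) 1.

Lemma rec_game : rec3 game.
Proof.
have rh := rec_heavy; rewrite /game /rec3.
apply: (rec_iteri (G := fun i u v =>
  minb (nth 0 v 1) (fun N => (u < N) && heavy (nth 0 v 0) i N u))); rec_tac.
Qed.

Lemma game_step c T t : game c T t.+1 < T ->
  game c T t < game c T t.+1 /\ heavy c t (game c T t.+1) (game c T t).
Proof.
move=> h; have [_ h2 _] := minb_spec T (fun N => (game c T t < N) && heavy c t N (game c T t)).
by apply/andP; apply: h2.
Qed.

(** A search result below the cutoff is the true minimum, hence the same for all larger cutoffs. *)
Lemma game_stable c T T' t : game c T t < T -> T <= T' -> game c T' t = game c T t.
Proof.
elim: t => // t IH h TT'; have [h1 h2] := game_step h.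
rewrite {1}/game /= -/(game c T' t) IH ?(ltn_trans h1) //.
apply: minb_eq; [exact: leq_trans TT'|by rewrite h1 h2|].
by have [] := minb_spec T (fun N => (game c T t < N) && heavy c t N (game c T t)).
Qed.

(* [move_code c t] codes a string of length [level t + c + 1].  The share of [c]
   among the strings of length [l] thus consists of [2 ^ (l - c - 1)] strings. *)
Definition turn n := n - 2 ^ trunc_log 2 n.+1.
Definition share n := trunc_log 2 n.+1 - 1 - level (turn n).
Definition move_code c t := 2 ^ (level t + c + 1) + t.

Lemma level_bounds t : 2 ^ level t <= t.+1 < 2 ^ (level t).+1.
Proof. by rewrite /level trunc_logP //= trunc_log_ltn. Qed.

Lemma log_move_code c t : trunc_log 2 (move_code c t).+1 = level t + c + 1.
Proof.
apply: trunc_log_eq => //; have /andP[_ h] := level_bounds t.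
rewrite /move_code -addnS leq_addr /= expnS mul2n -addnn ltn_add2l.
by apply: leq_trans h _; rewrite leq_exp2l // addn1 ltnS leq_addr.
Qed.

Lemma turn_move_code c t : turn (move_code c t) = t.
Proof. by rewrite /turn log_move_code addKn. Qed.

Lemma share_move_code c t : share (move_code c t) = c.
Proof. by rewrite /share log_move_code turn_move_code; lia. Qed.

(** Both [c] and the turn are read off the input, so one decompressor plays the games for all [c],
    and [c] may be chosen after its optimality constant is known. *)
Lemma game_decompressor : exists E, [/\ decompressor E &
  forall c t T p, string_code p = move_code c t -> game c T t < T ->
    E p = Some (game c T t)].
Proof.
have rG := rec_game.
have [|| cE hcE] := @mu_out (fun T n => game (share n) T (turn n) < T)
    (fun T n => game (share n) T (turn n)).
- by rewrite /share /level /turn; rec_tac.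
- by rewrite /share /level /turn; rec_tac.
have [E hE] := decompressor_of_recf cE; exists E; split; first by exists cE.
move=> c t T p hp hT; apply/hE; rewrite hp; apply/hcE.
rewrite share_move_code turn_move_code.
have exT : exists T, game c T t < T by exists T.
case: (ex_minnP exT) => T0 h0 hmin; exists T0; split=> //.
  by move=> i iT; apply/negP => /hmin; rewrite leqNgt iT.
by apply: game_stable => //; exact: hmin.
Qed.

(** The second hypothesis says that every described number gets an answer, so the game never waits
    forever. *)
Lemma game_play E c :
  (forall t T p, string_code p = move_code c t -> game c T t < T ->
    E p = Some (game c T t)) ->
  (forall t v p, 0 < v -> size p = level t + c + 1 -> E p = Some v ->
    exists2 N, v < N & heavy c t N v) ->
  exists v : nat -> nat, forall t, v t < v t.+1 /\ heavy c t (v t.+1) (v t).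
Proof.
move=> hE hN.
have : forall t, exists T, game c T t < T.
  elim=> [|t [T hT]]; first by exists 2.
  have [p hp] := string_code_surj (move_code c t).
  have [|||N vN hv] := hN t (game c T t) p.
  - case: t hT {hp} => // t /game_step[h _]; exact: leq_ltn_trans h.
  - by rewrite size_string_code hp log_move_code.
  - exact: hE.
  (* A cutoff above the answer [N], and at least the old one, makes the next search succeed from the
     same position. *)
  exists (maxn T N.+1).
  have E1 : game c (maxn T N.+1) t = game c T t by apply: game_stable; rewrite ?leq_maxl.
  rewrite /game /= -/(game c (maxn T N.+1) t) E1.
  by apply: (@minb_lt _ _ N); rewrite ?leq_maxr // vN hv.
move=> /choice[T hT]; exists (fun t => game c (T t) t) => t.
pose M := maxn (T t) (T t.+1).
rewrite -(@game_stable c (T t) M t) ?leq_maxl //.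
rewrite -(@game_stable c (T t.+1) M t.+1) ?leq_maxr //.
apply: game_step; rewrite (@game_stable c (T t.+1) M t.+1) ?leq_maxr //.
exact: leq_trans (leq_maxr _ _).
Qed.
End Game1.

(** * Kraft's inequality and the game against the prefix-free decompressor *)

(** Kraft's inequality with cumulative counts: a program of length [l] is counted at every [y >= l],
    with total below [2 ^ (K - l).+1]. The induction splits on the first bit; the empty program, if
    present, is the only one. *)
Lemma kraft_upto (D : seq bool -> bool) K :
  (forall p q, D p -> D q -> prefix p q -> p = q) ->
  \sum_(y < K) count D (strings_upto y) * 2 ^ (K - y) <= 2 ^ K.+1.
Proof.
elim: K D => [|K IH] D pfD; first by rewrite big_ord0.
case: (boolP (D [::])) => D0.
  have c1 y : count D (strings_upto y) = 1.
    have -> : count D (strings_upto y) = count (pred1 [::]) (strings_upto y).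
      apply: eq_count => p /=; apply/idP/eqP => [Dp|-> //].
      by apply: esym; apply: pfD; rewrite ?prefix0s.
    by case: y => //= y; rewrite count_cat !count_map /= !(@eq_count _ _ pred0) ?count_pred0.
  under eq_bigr => y _ do rewrite c1 mul1n.
  exact/ltnW/sum_exp2_rev_lt.
rewrite big_ord_recl /= (negbTE D0) mul0n add0n.
under eq_bigr => y _ do rewrite /bump /= add0n count_cat !count_map subSS mulnDl.
rewrite big_split /= [2 ^ K.+2]expnS mul2n -addnn; apply: leq_add.
  by apply: (IH (D \o cons false)) => p q Dp Dq pq;
    have := pfD _ _ Dp Dq; rewrite /= => /(_ pq)[].
by apply: (IH (D \o cons true)) => p q Dp Dq pq;
    have := pfD _ _ Dp Dq; rewrite /= => /(_ pq)[].
Qed.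

(** * The game for (ii): placing equal weights *)

Section Game2.
Variables (f g out : nat -> nat -> nat) (Kf : nat -> nat).
Hypotheses (rf : rec2 f) (rg : rec2 g) (ro : rec2 out) (rK : rec1 Kf).

(** A finite set of points is a bit mask, so that the recursion carries a single number; [bits]
    counts its elements below [n]. *)
Definition bits h n := bsum n (fun i => odd (h %/ 2 ^ i)).

(* [h] is the bit mask of the points that carry a weight, and [out s n = N.+1]
   means that the program coded by [n] outputs [N] within [s] steps. *)
Definition served c s h := bforall (Kf c) (fun x => bforall (Kf c) (fun y =>
  (2 * c < x) && pairb f g (Kf c) x y ==> bexists (2 ^ y.+1) (fun n =>
    (n.+1 < 2 ^ y.+1) && ((0 < out s n) && ((out s n <= s) &&
    (bits h s * 2 ^ x < bits h (out s n) * 2 ^ x + 2 ^ (Kf c + 2 * c))))))).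

(* Only the game of [stage s] may act at time [s]; every [c] gets infinitely many
   turns. *)
Definition stage s := s - 2 ^ trunc_log 2 s.

Definition place c s h :=
  (stage s == c) && ((bits h s < 2 ^ Kf c) && served c s h).

Definition hist c s := iteri s (fun i h => if place c i h then h + 2 ^ i else h) 0.

Definition placed c s := place c s (hist c s).

Lemma rec_bits : rec2 bits.
Proof. rewrite /bits; rec_tac. Qed.

Lemma rec_served : rec3 (fun c s h => served c s h).
Proof. have rp := rec_pairb rf rg; have rb := rec_bits; rewrite /served; rec_tac. Qed.

Lemma rec_stage : rec1 stage.
Proof. rewrite /stage; rec_tac. Qed.

Lemma rec_place : rec3 (fun c s h => place c s h).
Proof.
by have rb := rec_bits; have rs := rec_served; have rt := rec_stage; rewrite /place; rec_tac.
Qed.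

Lemma rec_hist : rec2 hist.
Proof.
have rp := rec_place; rewrite /hist /rec2.
apply: (rec_iteri (G := fun i h v => if place (nth 0 v 0) i h then h + 2 ^ i else h)); rec_tac.
Qed.

Lemma rec_placed : rec2 (fun c s => placed c s).
Proof. by have rp := rec_place; have rh := rec_hist; rewrite /placed; rec_tac. Qed.

Lemma histS c s : hist c s.+1 = hist c s + placed c s * 2 ^ s.
Proof. by rewrite /hist /= -/(hist c s) /placed; case: place; rewrite ?mul1n ?addn0. Qed.

Lemma hist_lt c s : hist c s < 2 ^ s.
Proof.
elim: s => // s IH; rewrite histS expnS.
by move: IH; case: placed; rewrite ?mul1n ?mul0n; move: (2 ^ s) (hist c s) => *; lia.
Qed.

(** Later moves only add higher bits, so the mask keeps the record of all earlier ones. *)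
Lemma hist_bit c s i : i < s -> odd (hist c s %/ 2 ^ i) = placed c i.
Proof.
elim: s => // s IH; rewrite ltnS leq_eqVlt histS => /orP[/eqP->|lt].
  by rewrite addnC divnMDl ?expn_gt0 // divn_small ?hist_lt // addn0 oddb.
rewrite addnC -[in 2 ^ s](subnK (ltnW lt)) expnD mulnA divnMDl ?expn_gt0 //.
rewrite oddD IH // oddM oddX /= subn_eq0 leqNgt lt /= andbF //.
Qed.

Definition cnt c n := \sum_(i < n) placed c i.

Lemma cntS c n : cnt c n.+1 = cnt c n + placed c n.
Proof. by rewrite /cnt big_ord_recr. Qed.

Lemma bits_hist c s n : n <= s -> bits (hist c s) n = cnt c n.
Proof.
move=> ns; rewrite /bits bsumE; apply: eq_bigr => i _.
by rewrite hist_bit // (leq_trans (ltn_ord i)).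
Qed.

Lemma cnt_mono c a b : a <= b -> cnt c a <= cnt c b.
Proof.
move=> /subnK <-; elim: (b - a) => // n IH; rewrite addSn cntS.
exact: leq_trans IH (leq_addr _ _).
Qed.

Lemma placedP c s : placed c s ->
  [/\ stage s = c, cnt c s < 2 ^ Kf c & served c s (hist c s)].
Proof. by rewrite /placed /place bits_hist // => /and3P[/eqP]. Qed.

Lemma cnt_le c n : cnt c n <= 2 ^ Kf c.
Proof.
elim: n => [|n IH]; first by rewrite /cnt big_ord0.
rewrite cntS; case: (boolP (placed c n)) => [/placedP[_ h _]|_]; last by rewrite addn0.
by rewrite addn1.
Qed.

Lemma cnt_hit c s j : j < cnt c s -> exists2 i, placed c i & cnt c i = j.
Proof.
elim: s => [|s IH]; first by rewrite /cnt big_ord0.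
case: (ltnP j (cnt c s)) => [/IH //|js]; rewrite cntS => h.
by exists s; move: h js; case: placed => //=; lia.
Qed.

(** Every number [2 ^ k + c] with [c < 2 ^ k] is a turn of [c]. *)
Lemma stage_often c s0 : exists2 s, s0 <= s & stage s = c.
Proof.
have h : s0 + c < 2 ^ (s0 + c) by exact: ltn_expl.
exists (2 ^ (s0 + c) + c); first by lia.
rewrite /stage (@trunc_log_eq 2 (s0 + c)) ?addKn // expnS leq_addr /=.
by move: h; move: (2 ^ (s0 + c)) => *; lia.
Qed.

Lemma cnt_full c :
  (exists s0, forall s, s0 <= s -> served c s (hist c s)) ->
  exists s, cnt c s = 2 ^ Kf c.
Proof.
move=> [s0 hs0].
suff : forall k, k <= 2 ^ Kf c -> exists s, k <= cnt c s.
  move=> /(_ _ (leqnn _))[s hs]; exists s; apply/eqP.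
  by rewrite eqn_leq cnt_le hs.
elim=> [|k IH] hk; first by exists 0.
have [s1 h1] := IH (ltnW hk).
have [s hs sc] := stage_often c (maxn s0 s1).
case: (ltnP k (cnt c s)) => [ks|ks]; first by exists s.
exists s.+1; rewrite cntS; suff -> : placed c s.
  by rewrite addn1 ltnS (leq_trans h1) // cnt_mono // (leq_trans (leq_maxr _ _) hs).
rewrite /placed /place sc eqxx bits_hist // (leq_ltn_trans ks hk) /=.
by apply: hs0; exact: leq_trans (leq_maxl _ _) hs.
Qed.

Variable P : seq bool -> option nat.
Hypothesis out_sound : forall s n N, out s n = N.+1 ->
  exists2 p, string_code p = n & P p = Some N.

(** Cut the [2 ^ Kf c] points into blocks of [l]. When a block has just been filled and another
    point is about to be placed, a program of length at most [y] has fewer than [l] points beyond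
    its output, so the output falls into that block. Different blocks thus need different
    programs. *)
Lemma many_programs c x y s : cnt c s = 2 ^ Kf c ->
  x < Kf c -> y < Kf c -> 2 * c < x -> pairb f g (Kf c) x y ->
  2 ^ x <= 2 ^ (2 * c + 1) * count (fun p => P p) (strings_upto y).
Proof.
move=> hs xK yK cx hxy.
pose l := 2 ^ (Kf c + 2 * c - x); pose B := (2 ^ (x - 2 * c)).-1.
have l0 : 0 < l by rewrite expn_gt0.
have hl : 2 ^ (x - 2 * c) * l = 2 ^ Kf c.
  by rewrite -expnD; congr expn; lia.
have hlx : 2 ^ (Kf c + 2 * c) = l * 2 ^ x by rewrite -expnD; congr expn; lia.
(* [F] recovers the block from the program: it is the block of the last point not beyond the
   output. *)
pose F p := ((cnt c (odflt 0 (P p)).+1).-1 %/ l)%N.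
have hB : B <= count (fun p => P p) (strings_upto y).
  rewrite -size_filter -(size_map F) -(size_iota 0 B).
  apply: uniq_leq_size (iota_uniq _ _) _ => b; rewrite mem_iota /= add0n => bB.
  have [|i pi ci] := @cnt_hit c s (b.+1 * l).
    rewrite hs -hl ltn_mul2r l0 /=; move: bB; rewrite /B; lia.
  have [_ _ /bforallP/(_ x xK)/bforallP/(_ y yK)] := placedP pi.
  rewrite cx hxy /= => /bexistsP[n _ /and4P[ny o0 oi]].
  case E : (out i n) o0 oi => [//|N] _ oi.
  rewrite !bits_hist // ci hlx -mulnDl ltn_mul2r expn_gt0 /= => lt.
  have [p hp PN] := out_sound E.
  have le : cnt c N.+1 <= b.+1 * l by rewrite -ci cnt_mono.
  apply/mapP; exists p.
    rewrite mem_filter PN mem_strings_upto /=.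
    rewrite size_string_code hp -ltnS -(@ltn_exp2l 2) //.
    by apply: leq_ltn_trans ny; exact: trunc_logP.
  apply/eqP; rewrite /F PN /= eqn_leq.
  rewrite leq_divRL // -[_ %/ _ <= b]ltnS ltn_divLR //.
  by move: lt le; rewrite !mulSn; move: (b * l) (cnt c N.+1) => *; lia.
apply: leq_trans (leq_mul (leqnn _) hB).
(* As [x > 2 * c], the number [2 ^ (x - 2 * c) - 1] of usable blocks is at least half of that
   power. *)
have -> : 2 ^ x = 2 ^ (2 * c + 1) * 2 ^ (x - 2 * c).-1 by rewrite -expnD; congr expn; lia.
rewrite leq_mul2l /B; apply/orP; right.
have -> : x - 2 * c = (x - 2 * c).-1.+1 by lia.
by rewrite expnS /=; have := expn_gt0 2 (x - 2 * c).-1; lia.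
Qed.

(** For fixed [y] the powers [2 ^ x] sum to at most twice the largest, hence to at most
    [2 ^ (2 * c + 2)] times the number of programs of length at most [y]. Kraft's inequality bounds
    the total by [2 ^ (K + 2 * c + 3)]. *)
Lemma full_cnt_not_rich c s : prefix_free P -> cnt c s = 2 ^ Kf c -> ~ rich f g (Kf c) c.
Proof.
move=> pfP hs; apply/negP; rewrite /rich -ltnNge; set K := Kf c.
pose A y := count (fun p => P p) (strings_upto y).
apply: (@leq_ltn_trans (2 ^ (2 * c + 2) * 2 ^ K.+1)); last first.
  by rewrite -expnD ltn_exp2l //; lia.
apply: leq_trans (leq_mul (leqnn _) (kraft_upto (D := fun p => P p) K _)); last first.
  by move=> p q Pp Pq; apply: pfP; [case: (P p) Pp|case: (P q) Pq].
rewrite /wsum bsumE; under eq_bigr => x _ do rewrite bsumE.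
rewrite exchange_big big_distrr /=; apply: leq_sum => y _.
pose Q x := [&& 2 * c < x, x <= y & pairb f g K x y].
have -> : \sum_(x < K) (if 2 * c < x then pairw f g K x y else 0) =
    (\sum_(x < K | Q x) 2 ^ x) * 2 ^ (K - y).
  rewrite big_distrl [RHS]big_mkcond /=; apply: eq_bigr => x _; rewrite /pairw /Q.
  case: ifP => //= _; case: ifP => // _; rewrite -expnD; congr expn.
  by have := ltn_ord y; lia.
rewrite mulnA leq_mul2r; apply/orP; right.
apply: leq_trans (sum_high_exp2 (a := 2 ^ (2 * c + 1) * A y) _) _.
  by move=> x xK /and3P[cx _ hxy]; exact: many_programs hs xK (ltn_ord y) cx hxy.
by rewrite mulnA -expnS addn2 addn1.
Qed.
End Game2.

Lemma prefix_decompressor_out P : prefix_decompressor P ->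
  exists out, [/\ rec2 out,
    forall s n N, out s n = N.+1 -> exists2 p, string_code p = n & P p = Some N &
    forall p N, P p = Some N -> exists s0, forall s, s0 <= s ->
      out s (string_code p) = N.+1].
Proof.
move=> [[c hc] _]; have [S [rS sS cS]] := clockedP c.
exists (fun s n => S s [:: n]); split.
- apply: rec_ext rS => v; case/tupleP: v => a v; case/tupleP: v => b v.
  by rewrite (tuple0 v).
- move=> s n N h; have [p hp] := string_code_surj n; exists p => //.
  by apply/hc; apply: (sS s); rewrite hp.
- by move=> p N /hc/cS.
Qed.

(** Ensures that [BP] has values: an optimal machine must describe what is described by a machine
    with the empty program alone. *)
Lemma optimal_prefix_program P : optimal_prefix_decompressor P ->
  exists p N, P p = Some N.
Proof.
move=> [_ hP]; pose E (p : seq bool) : option nat := if p is [::] then Some 0 else None.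
have hE : prefix_decompressor E.
  split; last by move=> [|a p] [|b q].
  (* The searched function ignores the search variable and returns the code of the input, so it
     halts exactly on code 0, with value 0. *)
  exists (RMu (RProj (lift ord0 ord0))) => p N; rewrite /E /=.
  split.
    by case: p => // -[<-]; split.
  move=> [h1 h2]; case: p h1 h2 => [|b p] //= _ h2.
  by case: N h2 => // N /(_ 0 isT)[].
have [c /(_ [::] 0 erefl)[q _ hq]] := not_worseP (hP E hE).
by exists q, 0.
Qed.

Local Open Scope ring_scope.
Local Open Scope classical_set_scope.

(** * Series and semicomputable reals *)

Lemma cvg_nat_eventually (u : nat -> nat) (l : nat) :
  u k @[k --> \oo] --> l -> exists k0, forall k, (k0 <= k)%N -> u k = l.
Proof.
move=> /(_ [set l] (discrete_set1 l)) [k0 _ hk].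
by exists k0 => k kk; exact: hk.
Qed.

Lemma nneseries_gt_partial (R : realType) (u : nat -> R) N (r : R) :
  (forall k, 0 <= u k) -> (r%:E < \sum_(N <= k <oo) (u k)%:E)%E ->
  exists n, r < \sum_(N <= k < n) u k.
Proof.
move=> u0 h; apply: contrapT => h'; move: h; apply/negP; rewrite -leNgt.
apply: lime_le; first by apply: is_cvg_nneseries => k _ _; rewrite lee_fin.
apply: nearW => n; rewrite sumEFin lee_fin leNgt; apply/negP => hn.
by apply: h'; exists n.
Qed.

Lemma partial_le_nneseries (R : realType) (u : nat -> R) N n (r : R) :
  (forall k, 0 <= u k) -> (\sum_(N <= k <oo) (u k)%:E < r%:E)%E ->
  \sum_(N <= k < n) u k < r.
Proof.
move=> u0 h; rewrite -lte_fin; apply: le_lt_trans h; rewrite -sumEFin.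
by apply: nneseries_lim_ge => k _ _; rewrite lee_fin.
Qed.

Section Summable.
Variables (R : realType) (m : nat -> R).
Hypothesis (m0 : forall k, 0 <= m k) (mcvg : cvgn (series m)).

Let partial_nd : {homo series m : a b / (a <= b)%N >-> a <= b}.
Proof.
move=> a b ab; rewrite /series /= (big_cat_nat _ ab) //= lerDl.
by apply: sumr_ge0.
Qed.

Lemma partial_le_lim a b : \sum_(a <= k < b) m k <= limn (series m) - series m a.
Proof.
case: (leqP a b) => ab.
  rewrite lerBrDl; have := nondecreasing_cvgn_le partial_nd mcvg b.
  by rewrite /series /= (big_cat_nat _ ab).
by rewrite big_geq 1?ltnW // subr_ge0 nondecreasing_cvgn_le.
Qed.

Lemma is_BP'_exists n : exists M, is_BP' m n M.
Proof.
pose A N := `[< (\sum_(N.+1 <= k <oo) (m k)%:E < (2 ^- n)%:E :> \bar R)%E >].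
have e0 : 0 < 2 ^- n / 2 :> R by rewrite divr_gt0 // invr_gt0 exprn_gt0.
have exA : exists N, A N.
  (* Keeping the partial tails below half of [2 ^- n] makes the infinite tail strictly smaller than
     [2 ^- n]. *)
  have [|N _ hN] := cvgr_gt (limn (series m)) mcvg (limn (series m) - 2 ^- n / 2).
    by rewrite ltrBlDr ltrDl.
  exists N; apply/asboolP; rewrite ltNge; apply/negP => h.
  have [||k] := @nneseries_gt_partial R m N.+1 (2 ^- n / 2).
  - exact: m0.
  - apply: lt_le_trans h; rewrite lte_fin; lra.
  - rewrite ltNge => /negP; apply; apply: le_trans (partial_le_lim _ _) _.
    have /= := hN N.+1 (leqnSn N); lra.
case: (ex_minnP exA) => M /asboolP hM hmin; exists M; split=> // l hl.
by apply: hmin; apply/asboolP.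
Qed.

End Summable.

(** [d k N] is the positive part of the [N]-th approximation times [2 ^ N], rounded down. Truncated
    subtraction takes the positive part, which stays below [m k] because [m k >= 0]. *)
Lemma lsc_dyadic_bounds (R : realType) (m : nat -> R) :
  lower_semicomputable_real m -> (forall k, 0 <= m k) ->
  exists d : nat -> nat -> nat, [/\ rec2 d,
    forall k N, (d k N)%:R <= 2 ^+ N * m k &
    forall k (e : R), 0 < e -> exists N0, forall N, (N0 <= N)%N ->
      2 ^+ N * (m k - e) <= (d k N)%:R].
Proof.
move=> [q [[a [b [c [ca cb cc hq]]]] qnd qcvg]] m0.
have [ra rb rc] : [/\ rec2 a, rec2 b & rec2 c] by split; apply/computable2_rec2.
pose A k N := ((a k N - b k N) * 2 ^ N)%N.
exists (fun k N => (A k N %/ (c k N).+1)%N); split.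
- rewrite /A; rec_tac.
- move=> k N; have cpos : 0 < (c k N).+1%:R :> R by rewrite ltr0n.
  apply: (@le_trans _ _ ((A k N)%:R / (c k N).+1%:R)).
    by rewrite ler_pdivlMr // -natrM ler_nat leq_divM.
  rewrite /A natrM natrX mulrAC mulrC ler_wpM2l ?exprn_ge0 //.
  case: (leqP (b k N) (a k N)) => ab; last first.
    by rewrite (eqP (ltnW ab)) mul0r.
  rewrite natrB // -hq -(cvg_lim _ (qcvg k)) //.
  by apply: nondecreasing_cvgn_le => [i j|]; [exact: qnd|exact: cvgP (qcvg k)].
- move=> k e e0; have e2 : 0 < e / 2 by rewrite divr_gt0.
  have [|N1 _ h1] := cvgr_gt (m k) (qcvg k) (m k - e / 2); first by lra.
  (* Half of the error [e] goes to the approximation, half to rounding, which costs one unit on the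
     scale [2 ^ N >= 2 / e]. *)
  have [N2 h2] : exists N2, 2 / e <= N2%:R :> R.
    by exists (Num.bound (2 / e)); apply/ltW/archi_boundP; rewrite divr_ge0 // ltW.
  exists (maxn N1 N2) => N; rewrite geq_max => /andP[hN1 hN2].
  have cpos : 0 < (c k N).+1%:R :> R by rewrite ltr0n.
  have hq1 : m k - e / 2 < q k N := h1 N hN1.
  have hd : (A k N)%:R / (c k N).+1%:R <= (A k N %/ (c k N).+1)%:R + 1 :> R.
    rewrite ler_pdivrMr // natr1 -natrM ler_nat.
    by apply/ltnW; rewrite ltn_ceil.
  have hA : 2 ^+ N * q k N <= (A k N)%:R / (c k N).+1%:R.
    rewrite hq mulrA ler_pM2r ?invr_gt0 // /A natrM natrX mulrC ler_wpM2r ?exprn_ge0 //.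
    by rewrite lerBlDr -natrD ler_nat; lia.
  have hp : 2 / e <= 2 ^+ N.
    apply: le_trans h2 _; rewrite -natrX ler_nat.
    exact: leq_trans hN2 (ltnW (ltn_expl _ _)).
  have h3 : 1 <= 2 ^+ N * (e / 2).
    by move: hp; rewrite ler_pdivrMr //; lra.
  have h4 : 2 ^+ N * (m k - e / 2) <= 2 ^+ N * q k N.
    by rewrite ler_wpM2l ?exprn_ge0 // ltW.
  have h5 : 2 ^+ N * (m k - e) = 2 ^+ N * (m k - e / 2) - 2 ^+ N * (e / 2).
    by rewrite -mulrBr; congr (_ * _); lra.
  rewrite h5; move: h3 h4 (le_trans hA hd); clear.
  move: (2 ^+ N * (m k - e / 2)) (2 ^+ N * (e / 2)) (2 ^+ N * q k N) (_%:R) => *; lra.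
Qed.

(** The exponent [y.+1] halves the demand, so that a tail of just [2 ^- y] is noticed: a finite part
    exceeds 3/4 of it, and the approximations lose at most 1/4. *)
Lemma heavy_eventually (R : realType) (m : nat -> R) (d : nat -> nat -> nat) v y :
  (forall k, 0 <= m k) ->
  (forall k (e : R), 0 < e -> exists N0, forall N, (N0 <= N)%N ->
      2 ^+ N * (m k - e) <= (d k N)%:R) ->
  ((2 ^- y)%:E <= \sum_(v <= k <oo) (m k)%:E :> \bar R)%E ->
  exists N0, forall N, (N0 <= N)%N ->
    (2 ^ N <= 2 ^ y.+1 * bsum N (fun k => if v <= k then d k N else 0))%N.
Proof.
move=> m0 hd htail.
have p0 : 0 < 2 ^- y :> R by rewrite invr_gt0 exprn_gt0.
have [||n hn] := @nneseries_gt_partial R m v (2 ^- y * (3 / 4)); [by []| |].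
  by apply: lt_le_trans htail; rewrite lte_fin; lra.
(* The loss of [2 ^- y / 4] is spread over at most [n] terms; [n.+1] avoids a zero denominator. *)
pose e : R := 2 ^- y / 4 / n.+1%:R.
have e0 : 0 < e by rewrite !divr_gt0 // ltr0n.
have [N0 hN0] := eventually_common n (fun k => hd k e e0).
exists (maxn N0 n) => N; rewrite geq_max => /andP[h0 hnN].
rewrite bsumE -(ler_nat R) natrM !natrX.
have hs : \sum_(v <= k < n) (2 ^+ N * (m k - e)) <=
    (\sum_(i < N) (if (v <= i)%N then d i N else 0))%:R :> R.
  rewrite natr_sum -(big_mkord xpredT (fun i => (if (v <= i)%N then d i N else 0)%:R : R)).
  rewrite (big_cat_nat _ hnN) //=; apply: ler_wpDr; first by apply: sumr_ge0.
  rewrite (big_nat_widenl v 0) // big_mkcond [X in X <= _]big_nat_cond.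
  rewrite [X in _ <= X]big_nat_cond /=.
  apply: ler_sum => k /andP[kn _]; case: ifP => // _.
  exact: hN0.
have hsum : 2 ^+ N * (2 ^- y / 2) <= \sum_(v <= k < n) (2 ^+ N * (m k - e)).
  rewrite -big_distrr /= ler_wpM2l ?exprn_ge0 // sumrB sumr_const_nat.
  have : e *+ (n - v) <= 2 ^- y / 4.
    rewrite -[e *+ _]mulr_natr /e mulrAC ler_pdivrMr ?ltr0n //.
    rewrite ler_wpM2l ?divr_ge0 ?(ltW p0) //.
    by rewrite ler_nat leqW // leq_subr.
  move: hn; set S := \sum_(_ <= _ < _) _; set E := _ *+ _; lra.
move/(le_trans hsum): hs => /(ler_wpM2l (exprn_ge0 y.+1 (ler0n R 2))).
apply: le_trans; rewrite exprS.
have a0 : 2 ^+ y != 0 :> R by rewrite expf_neq0.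
move: (2 ^+ y : R) (2 ^+ N : R) a0 => a c a0.
by rewrite [X in _ <= X](_ : _ = c) //; field.
Qed.

Lemma sum_low_exp2_real (R : realType) K (Q : pred nat) (a : R) : 0 <= a ->
  (forall y, (y < K)%N -> Q y -> (2 ^ (K - y))%:R <= a) ->
  (\sum_(y < K | Q y) 2 ^ (K - y))%:R <= 2 * a.
Proof.
move=> a0 h; pose b := (\max_(y < K | Q y) 2 ^ (K - y))%N.
apply: (@le_trans _ _ (2 * b%:R)).
  rewrite -natrM ler_nat; apply: sum_low_exp2 => y yK Qy.
  exact: (@leq_bigmax_cond _ (fun i : 'I_K => Q i) (fun i => 2 ^ (K - i))%N (Ordinal yK)).
rewrite ler_wpM2l // /b; elim/big_ind: _ => // [p q hp hq|i Qi]; last exact: h.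
by case: (leqP p q) => pq; rewrite ?(maxn_idPr pq) // (maxn_idPl (ltnW pq)).
Qed.

Lemma sum_shift (R : realType) K a (h : nat -> R) :
  \sum_(x < K) (if (a < x)%N then h (x - a.+1)%N else 0) =
  \sum_(0 <= e < K - a.+1) h e.
Proof.
elim: K => [|K IH]; first by rewrite big_ord0 big_geq.
rewrite big_ord_recr /= IH; case: ifP => aK; first by rewrite subSn // big_nat_recr.
by rewrite addr0 !big_geq //; lia.
Qed.

Lemma steps_sum (R : realType) (u : nat -> R) a n (r : R) :
  (forall i, (a <= i < a + n)%N -> r <= u i.+1 - u i) ->
  n%:R * r <= u (a + n)%N - u a.
Proof.
elim: n => [|n IH] h; first by rewrite mul0r addn0 subrr.
have h1 : n%:R * r <= u (a + n)%N - u a by apply: IH => i hi; apply: h; lia.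
have h2 : r <= u (a + n).+1 - u (a + n)%N by apply: h; lia.
rewrite -natr1 mulrDl mul1r addnS; move: h1; move: (n%:R * r) => w; lra.
Qed.

(** * The mass of [m] consumed by the first game *)

Section HeavyChain.
Variables (R : realType) (m : nat -> R) (f g d : nat -> nat -> nat).
Variables (Kf : nat -> nat) (c : nat) (v : nat -> nat).
Let K := Kf c.
Hypotheses (m0 : forall k, 0 <= m k)
  (mS : forall n, \sum_(0 <= k < n) m k <= 2 ^+ c)
  (d_le : forall k N, (d k N)%:R <= 2 ^+ N * m k)
  (vP : forall t, (v t < v t.+1)%N /\ heavy f g d Kf c t (v t.+1) (v t)).

Let mass t := \sum_(0 <= k < v t) m k.

(** The sum in [heavy] runs over points from [v t] to below [v t.+1], and [d] underestimates [m], so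
    [m] really has this mass there. *)
Let mass_step t y : (y < K)%N -> pairb f g K (level t + 2 * c + 1) y ->
  2 ^- y.+1 <= mass t.+1 - mass t.
Proof.
move=> yK hp; have [vt /bforallP/(_ y yK)] := vP t; rewrite hp /=.
rewrite -(ler_nat R) natrM !natrX bsumE => h.
have -> : mass t.+1 - mass t = \sum_(v t <= k < v t.+1) m k.
  by rewrite /mass (big_cat_nat _ (ltnW vt)) //= addrAC subrr add0r.
rewrite -div1r ler_pdivrMr ?exprn_gt0 //.
rewrite -(@ler_pM2l _ (2 ^+ v t.+1)) ?exprn_gt0 // mulr1.
apply: le_trans h _; rewrite mulrA mulrC ler_wpM2r ?exprn_ge0 //.
rewrite natr_sum -(big_mkord xpredT
  (fun i => (if (v t <= i)%N then d i (v t.+1) else 0)%:R : R)).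
rewrite (big_nat_widenl (v t) 0) // big_distrr /= [X in _ <= X]big_mkcond /=.
by apply: ler_sum => k _; case: ifP.
Qed.

Let mass_nd t : mass t <= mass t.+1.
Proof.
have [vt _] := vP t; rewrite /mass [X in _ <= X](big_cat_nat _ (ltnW vt)) //=.
by rewrite lerDl; apply: sumr_ge0.
Qed.

(** The mass passed during the turns of level [e]. *)
Let gain e := mass (2 ^ e.+1).-1 - mass (2 ^ e).-1.

Let block_end e : ((2 ^ e).-1 + 2 ^ e = (2 ^ e.+1).-1)%N.
Proof. by rewrite expnS; have := expn_gt0 2 e; lia. Qed.

Let gain_ge e y : (y < K)%N -> pairb f g K (e + 2 * c + 1) y ->
  2 ^+ e * 2 ^- y.+1 <= gain e.
Proof.
move=> yK hp; rewrite /gain -block_end -natrX; apply: steps_sum => t ht.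
apply: mass_step => //; suff -> : level t = e by [].
by apply: trunc_log_eq => //; rewrite expnS; move: ht; have := expn_gt0 2 e; lia.
Qed.

Let gain_ge0 e : 0 <= gain e.
Proof.
rewrite /gain -block_end; apply: (@le_trans _ _ ((2 ^ e)%:R * 0)); first by rewrite mulr0.
by apply: steps_sum => t _; rewrite subr_ge0.
Qed.

(** Every [y] occurring with [x = e + 2 * c + 1] has [2 ^ (K - y)] at most [2 ^ (K + 1 - e)] times
    the gain. Summing over [y] costs a factor 2, and the factor [2 ^ x] cancels [2 ^ e]. *)
Let row_le e : (\sum_(y < K) pairw f g K (e + 2 * c + 1) y)%:R <=
  2 ^+ (K + 2 * c + 3) * gain e.
Proof.
set x := (e + 2 * c + 1)%N.
have -> : (\sum_(y < K) pairw f g K x y =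
    2 ^ x * \sum_(y < K | (x <= y)%N && pairb f g K x y) 2 ^ (K - y))%N.
  rewrite big_distrr [RHS]big_mkcond /=; apply: eq_bigr => y _; rewrite /pairw.
  by case: ifP => // _; rewrite -expnD; congr expn; have := ltn_ord y; lia.
have e0 : 0 < 2 ^+ e :> R by rewrite exprn_gt0.
have hs := @sum_low_exp2_real R K (fun y => (x <= y)%N && pairb f g K x y)
  (2 ^+ K.+1 / 2 ^+ e * gain e).
rewrite natrM natrX; apply: le_trans (ler_wpM2l _ (hs _ _)) _; first by rewrite exprn_ge0.
- by rewrite mulr_ge0 // divr_ge0 // ?exprn_ge0 // ltW.
- move=> y yK /andP[_ hp]; have := gain_ge yK hp.
  rewrite mulrAC ler_pdivlMr // => h.
  apply: le_trans (ler_wpM2l _ h); last by rewrite exprn_ge0.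
  rewrite mulrCA mulrC ler_wpM2l ?(ltW e0) // ler_pdivlMr ?exprn_gt0 //.
  by rewrite natrX -exprD; have -> : (K - y + y.+1 = K.+1)%N by lia.
- rewrite le_eqVlt; apply/orP; left; apply/eqP.
  rewrite /x !exprD !expr1 !exprS expr0 mulr1; field.
  by rewrite expf_neq0.
Qed.

(** The gains telescope to at most the total mass [2 ^ c], so the sum over pairs is at most
    [2 ^ (K + 3 * c + 3)]. *)
Lemma heavy_chain_not_rich : ~ rich f g K c.
Proof.
rewrite /rich -(ler_nat R) => h.
have : 2 ^+ (K + 4 * c + 8) <= 2 ^+ (K + 2 * c + 3) * 2 ^+ c :> R.
  apply: (le_trans (y := (wsum f g (2 * c) K)%:R)); first by rewrite -natrX.
  have -> : (wsum f g (2 * c) K)%:R =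
      \sum_(x < K) (if (2 * c < x)%N then
        (\sum_(y < K) pairw f g K ((x - (2 * c).+1) + 2 * c + 1) y)%:R else 0) :> R.
    rewrite /wsum bsumE natr_sum; apply: eq_bigr => x _; rewrite bsumE.
    case: ifP => hx; last by rewrite big1.
    by have -> : (x - (2 * c).+1 + 2 * c + 1 = x)%N by lia.
  rewrite (sum_shift _ _ (fun e => (\sum_(y < K) pairw f g K (e + 2 * c + 1) y)%:R)).
  apply: le_trans (ler_sum _ (fun e _ => row_le e)) _.
  rewrite -big_distrr /= ler_wpM2l ?exprn_ge0 //.
  rewrite /gain telescope_sumr // lerBlDr.
  by apply: le_trans (mS _) _; rewrite lerDl; apply: sumr_ge0.
by rewrite -exprD ler_eXn2l ?ltr1n //; lia.
Qed.
End HeavyChain.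

Lemma exp2_unbounded (R : realType) (r : R) c0 : exists2 c, (c0 <= c)%N & r <= 2 ^+ c.
Proof.
exists (maxn c0 (Num.bound r)); first exact: leq_maxl.
case: (lerP r 0) => [r0|/ltW r0]; first by apply: le_trans r0 _; rewrite exprn_ge0.
apply: le_trans (ltW (archi_boundP r0)) _; rewrite -natrX ler_nat.
exact: leq_trans (leq_maxr _ _) (ltnW (ltn_expl _ _)).
Qed.

(** * Proof of (i) *)

Section BGap.
Variables (R : realType) (m : nat -> R) (D : seq bool -> option nat).
Variables (x y : nat -> nat) (f g : nat -> nat -> nat) (Kf : nat -> nat).
Hypotheses (HD : optimal_decompressor D) (Hm : summable_lsc m).
Hypotheses (rf : rec2 f) (rg : rec2 g) (rK : rec1 Kf).
Hypotheses (fx : forall n k, (f n k <= x n)%N) (gy : forall n k, (y n <= g n k)%N).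
Hypothesis richK : forall c, rich f g (Kf c) c.

Lemma B_gt_BP' : exists n b b', [/\ is_B D (x n) b, is_BP' m (y n) b' & (b' < b)%N].
Proof.
have [mlsc m0 mcvg] := Hm.
have [d [rd d_le d_ge]] := lsc_dyadic_bounds mlsc m0.
have [E [decE hE]] := game_decompressor rf rg rd rK.
have [cE hcE] := not_worseP (HD.2 E decE).
(* [2 ^ c] bounds the total mass, and [c >= cE] brings a string of length [level t + c + 1] to a
   description of length at most [level t + 2 * c + 1], hence at most [x n]. *)
have [c cEc hS] := exp2_unbounded (limn (series m)) cE.
apply: contrapT => hcontra.
have [||v vP] := @game_play f g d Kf E c; first by move=> t T p; exact: hE.
  move=> t v p v0 sp hp.
  have tail n : f n (Kf c) = (level t + 2 * c + 1)%N ->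
      ((2 ^- y n)%:E <= \sum_(v <= k <oo) (m k)%:E :> \bar R)%E.
    move=> hn; have [q hq Dq] := hcE _ _ hp.
    have [|b Bb vb] := @is_B_exists D q v (x n) _ Dq.
      by apply: leq_trans hq _; rewrite sp; have := fx n (Kf c); lia.
    have [b' Bb'] := is_BP'_exists m0 mcvg (y n).
    have bb' : (b <= b')%N.
      by rewrite leqNgt; apply/negP => lt; apply: hcontra; exists n, b, b'.
    (* The tail from [v] is the tail beyond [v.-1], where [v > 0]; were it small, [b'] would be at
       most [v.-1], below [b]. *)
    rewrite leNgt; apply/negP => htail.
    have [_ /(_ v.-1)] := Bb'; rewrite /= prednK // => /(_ htail).
    by move: v0 vb bb'; clear; lia.
  have : forall y0, exists N0, forall N, (N0 <= N)%N ->
      pairb f g (Kf c) (level t + 2 * c + 1) y0 ->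
      (2 ^ N <= 2 ^ y0.+1 * bsum N (fun k => if (v <= k)%N then d k N else 0))%N.
    move=> y0; case: (boolP (pairb f g (Kf c) (level t + 2 * c + 1) y0)) => [|_];
      last by exists 0%N.
    move=> /bexistsP[n _ /andP[/eqP fn /eqP gn]].
    have [|N0 hN0] := @heavy_eventually R m d v y0 m0 d_ge; last by exists N0 => N /hN0.
    (* The approximation from above is at least [y n], so it demands no more mass than the limit
       does. *)
    apply: le_trans (tail n fn); rewrite lee_fin -gn lef_pV2 ?posrE ?exprn_gt0 //.
    by rewrite ler_eXn2l ?ltr1n // gy.
  move=> /(eventually_common (Kf c))[N0 hN0].
  exists (maxn N0 v.+1); first exact: leq_maxr.
  by apply/bforallP => y0 y0K; apply/implyP; apply: hN0 => //; exact: leq_maxl.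
apply: (@heavy_chain_not_rich R m f g d Kf c v) => // n.
apply: le_trans hS; apply: le_trans (partial_le_lim m0 mcvg 0 n) _.
by rewrite /series /= big_geq // subr0.
Qed.
End BGap.

(** * The semimeasure built by the second game *)

Section Weights.
Variables (R : realType) (f g out : nat -> nat -> nat) (Kf : nat -> nat).
Hypotheses (rf : rec2 f) (rg : rec2 g) (ro : rec2 out) (rK : rec1 Kf).
Local Notation placed_ := (placed f g out Kf).
Local Notation cnt_ := (cnt f g out Kf).

(** Point [s] belongs to the game of [stage s] only. Game [c] owns the share [2 ^- c.+1], divided
    equally among [2 ^ Kf c] points. *)
Definition weight s : R :=
  (placed_ (stage s) s)%:R / 2 ^+ (Kf (stage s) + stage s + 1).

Lemma weight_ge0 s : 0 <= weight s.
Proof. by rewrite divr_ge0 // exprn_ge0. Qed.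

Lemma placed_weight c s : (placed_ c s)%:R / 2 ^+ (Kf c + c + 1) <= weight s.
Proof.
case: (boolP (placed_ c s)) => [h|_]; last by rewrite mul0r weight_ge0.
by rewrite /weight; have [-> _ _] := placedP h; rewrite h.
Qed.

Lemma sum_half n : \sum_(c < n) 2 ^- c.+1 <= 1 - 2 ^- n :> R.
Proof.
elim: n => [|n IH]; first by rewrite big_ord0 expr0 invr1 subrr.
rewrite big_ord_recr /=; have -> : 2 ^- n.+1 = 2 ^- n / 2 :> R by rewrite exprS invfM mulrC.
by move: IH; move: (\sum_(i < n) _) (2 ^- n : R) => *; lra.
Qed.

Lemma weight_sum_le n : \sum_(0 <= s < n) weight s <= 1.
Proof.
rewrite big_mkord.
apply: (@le_trans _ _ (\sum_(s < n) \sum_(c < n) (placed_ c s)%:R / 2 ^+ (Kf c + c + 1))).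
  apply: ler_sum => s _.
  have st : (stage s < n)%N by apply: leq_ltn_trans (ltn_ord s); exact: leq_subr.
  rewrite (bigD1 (Ordinal st)) //= lerDl; apply: sumr_ge0 => c _.
  by rewrite divr_ge0 // exprn_ge0.
rewrite exchange_big /=; apply: le_trans (_ : _ <= \sum_(c < n) 2 ^- c.+1) _; last first.
  by apply: le_trans (sum_half n) _; rewrite gerBl invr_ge0 exprn_ge0.
apply: ler_sum => c _; rewrite -big_distrl /= -natr_sum -/(cnt_ c n).
rewrite ler_pdivrMr ?exprn_gt0 // -addnA addn1 exprD mulrCA mulVf ?expf_neq0 // mulr1.
by rewrite -natrX ler_nat cnt_le.
Qed.

Lemma weight_summable : summable_lsc weight.
Proof.
split; last first.
- apply: nondecreasing_is_cvgn; last by exists 1 => _ [n _ <-]; exact: weight_sum_le.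
  move=> a b ab; rewrite /series /= (big_cat_nat _ ab) //= lerDl.
  by apply: sumr_ge0 => s _; exact: weight_ge0.
- exact: weight_ge0.
exists (fun s _ => weight s); split=> [||s]; [|by []|exact: cvg_cst].
have rp := rec_placed rf rg ro rK; have rs := rec_stage.
exists (fun s _ => placed_ (stage s) s : nat), (fun _ _ => 0%N),
  (fun s _ => (2 ^ (Kf (stage s) + stage s + 1)).-1); split.
- apply/computable2_rec2.
  exact: (app2 rp (app1 rs (rec_nth 2 0)) (rec_nth 2 0)).
- by apply/computable2_rec2; exact: rec_const.
- apply/computable2_rec2/rec_pred; apply: rec_exp; first exact: rec_const.
  have rt := app1 rs (rec_nth 2 0).
  exact: rec_add (rec_add (app1 rK rt) rt) (rec_const _ _).
- by move=> s _; rewrite subr0 prednK ?expn_gt0 // natrX.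
Qed.

Lemma cnt_weight c a b : (a <= b)%N ->
  (cnt_ c b)%:R - (cnt_ c a)%:R <= 2 ^+ (Kf c + c + 1) * \sum_(a <= s < b) weight s.
Proof.
move=> ab.
have -> : (cnt_ c b)%:R - (cnt_ c a)%:R = \sum_(a <= s < b) (placed_ c s)%:R :> R.
  rewrite /cnt -!(big_mkord xpredT (fun i => placed_ c i : nat)).
  by rewrite (big_cat_nat _ ab) //= natrD addrAC subrr add0r natr_sum.
rewrite big_distrr /=; apply: ler_sum => s _.
by rewrite -ler_pdivrMl ?exprn_gt0 // mulrC placed_weight.
Qed.
End Weights.

(** * Proof of (ii) *)

Section BPGap.
Variables (R : realType) (m : nat -> R) (P : seq bool -> option nat).
Variables (x y : nat -> nat) (f g : nat -> nat -> nat) (Kf : nat -> nat).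
Hypotheses (HP : optimal_prefix_decompressor P) (Hm : apriori_probability m).
Hypotheses (rf : rec2 f) (rg : rec2 g) (rK : rec1 Kf).
Hypothesis xy : forall n, (x n <= y n)%N.
Hypotheses (fx : forall n k, (f n k <= x n)%N) (gy : forall n k, (y n <= g n k)%N).
Hypothesis richK : forall c, rich f g (Kf c) c.

Lemma BP'_gt_BP : exists n b' b, [/\ is_BP' m (x n) b', is_B P (y n) b & (b < b')%N].
Proof.
have [[mlsc m0 mcvg] mopt] := Hm.
have [out [ro out_sound out_complete]] := prefix_decompressor_out HP.1.
have [p0 [N0 hp0]] := optimal_prefix_program HP.
have [C [C0 hC]] := mopt _ (weight_summable R rf rg ro rK).
(* [2 ^ c >= 2 * C] absorbs both the domination constant and the extra 1 in the exponent of the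
   weights; [c >= size p0] ensures that [BP] is defined at each [y n] considered. *)
have [c cp0 hc] := exp2_unbounded (2 * C) (size p0).
apply: contrapT => hcontra.
suff [s hs] : exists s, cnt f g out Kf c s = (2 ^ Kf c)%N.
  exact: (full_cnt_not_rich out_sound HP.1.2 hs).
apply: cnt_full.
have : forall a, exists s1, forall s, (s1 <= s)%N -> forall b, (b < Kf c)%N ->
  (2 * c < a)%N && pairb f g (Kf c) a b -> bexists (2 ^ b.+1) (fun n =>
    (n.+1 < 2 ^ b.+1)%N && ((0 < out s n)%N && ((out s n <= s)%N &&
    (bits (hist f g out Kf c s) s * 2 ^ a <
     bits (hist f g out Kf c s) (out s n) * 2 ^ a + 2 ^ (Kf c + 2 * c))%N))).
  move=> a.
  suff /(eventually_common (Kf c))[s1 hs1] : forall b, exists s1, forall s, (s1 <= s)%N ->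
    (2 * c < a)%N && pairb f g (Kf c) a b -> bexists (2 ^ b.+1) (fun n =>
    (n.+1 < 2 ^ b.+1)%N && ((0 < out s n)%N && ((out s n <= s)%N &&
    (bits (hist f g out Kf c s) s * 2 ^ a <
     bits (hist f g out Kf c s) (out s n) * 2 ^ a + 2 ^ (Kf c + 2 * c))%N))).
    by exists s1 => s ss b bK; exact: hs1.
  move=> b; case: (boolP (_ && _)) => [/andP[ca]|_]; last by exists 0%N.
  move=> /bexistsP[n _ /andP[/eqP fn /eqP gn]].
  have cy : (size p0 <= y n)%N.
    by have := fx n (Kf c); have := xy n; rewrite fn; lia.
  have [N BN _] := is_B_exists cy hp0.
  have [b' Bb'] := is_BP'_exists m0 mcvg (x n).
  have bN : (b' <= N)%N.
    by rewrite leqNgt; apply/negP => lt; apply: hcontra; exists n, b', N.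
  have [/complexity_leP[p py hp] _] := BN.
  have [s1 hs1] := out_complete _ _ hp.
  (* By then the program [p] for [N] has halted and [out], which stores [N.+1], is at most [s]. *)
  exists (maxn s1 N.+1) => s; rewrite geq_max => /andP[ss Ns] _.
  have code_lt : ((string_code p).+1 < 2 ^ b.+1)%N.
    have /andP[_ h] := string_code_bounds p; apply: leq_trans h _.
    by rewrite leq_exp2l // ltnS (leq_trans py) // -gn.
  apply/bexistsP; exists (string_code p); first exact: ltnW.
  rewrite hs1 //; apply/and4P; split=> //; rewrite !bits_hist //.
  (* Since [b' <= N], the tail beyond [N] is below [2 ^- x n], and the approximation [a] is at most
     [x n]. *)
  have tail : \sum_(N.+1 <= k < s) m k < 2 ^- a.
    apply: (@le_lt_trans _ _ (\sum_(b'.+1 <= k < s) m k)).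
      by rewrite (@big_cat_nat _ _ _ N.+1 b'.+1) //= lerDr; apply: sumr_ge0.
    apply: (@lt_le_trans _ _ (2 ^- x n)).
      by apply: partial_le_nneseries => //; exact: Bb'.1.
    by rewrite lef_pV2 ?posrE ?exprn_gt0 // ler_eXn2l ?ltr1n // -fn.
  have hw : \sum_(N.+1 <= k < s) weight R f g out Kf k < C * 2 ^- a.
    apply: (@le_lt_trans _ _ (C * \sum_(N.+1 <= k < s) m k)); last by rewrite ltr_pM2l.
    by rewrite big_distrr; apply: ler_sum => k _; exact: hC.
  have h : (cnt f g out Kf c s)%:R - (cnt f g out Kf c N.+1)%:R <
      2 ^+ (Kf c + c + 1) * (C * 2 ^- a).
    by apply: le_lt_trans (cnt_weight R f g out Kf c Ns) _; rewrite ltr_pM2l ?exprn_gt0.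
  rewrite -(ltr_nat R) natrD !natrM !natrX -ltrBlDl -mulrBl.
  rewrite -ltr_pdivlMr ?exprn_gt0 //; apply: lt_le_trans h _.
  rewrite mulrA ler_wpM2r ?invr_ge0 ?exprn_ge0 //.
  have -> : (Kf c + 2 * c = Kf c + c + c)%N by lia.
  rewrite addn1 exprSr -mulrA [X in _ <= X]exprD ler_wpM2l ?exprn_ge0 //.
move=> /(eventually_common (Kf c))[s1 hs1]; exists s1 => s ss.
apply/bforallP => a aK; apply/bforallP => b bK; apply/implyP.
exact: hs1.
Qed.
End BPGap.

(** * Semicomputability and divergence in the form used by the games *)

Theorem theorem2 (R : realType)
    (D : seq bool -> option nat) (HD : optimal_decompressor D)
    (P : seq bool -> option nat) (HP : optimal_prefix_decompressor P)
    (m : nat -> R) (Hm : apriori_probability m)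
    (x y : nat -> nat)
    (xy_distinct : injective (fun n => (x n, y n)))
    (x_le_y : forall n, (x n <= y n)%N)
    (x_lower : lower_semicomputable x)
    (y_upper : upper_semicomputable y)
    (xy_sum : (\sum_(0 <= n <oo) (2 ^ ((x n)%:Z - (y n)%:Z) : R)%:E = +oo)%E) :
  (exists n b b' : nat,
      [/\ is_B D (x n) b, is_BP' m (y n) b' & (b' < b)%N]) /\
  (exists n b' b : nat,
      [/\ is_BP' m (x n) b', is_B P (y n) b & (b < b')%N]).
Proof.
have [f [/computable2_rec2 rf f_nd f_cvg]] := x_lower.
have [g [/computable2_rec2 rg g_ni g_cvg]] := y_upper.
have f_ev n := cvg_nat_eventually (f_cvg n).
have g_ev n := cvg_nat_eventually (g_cvg n).
have fx n k : (f n k <= x n)%N.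
  have [k0 hk] := f_ev n; rewrite -(hk (maxn k0 k)) ?leq_maxl //.
  by apply: f_nd; exact: leq_maxr.
have gy n k : (y n <= g n k)%N.
  have [k0 hk] := g_ev n; rewrite -(hk (maxn k0 k)) ?leq_maxl //.
  by apply: g_ni; exact: leq_maxr.
have term_eq n K : (y n <= K)%N ->
    (2 ^ (K + x n - y n))%:R = 2 ^+ K * 2 ^ ((x n)%:Z - (y n)%:Z) :> R.
  move=> yK; rewrite natrX !exprnP -expfzDr //; congr (_ ^ _).
  by have := x_le_y n; lia.
(* Divergence in integers: all terms are scaled by [2 ^ K], with [K] bounding the exponents
   [y n]. *)
have unbounded A : exists M, forall K, (forall n, (n < M)%N -> (y n <= K)%N) ->
    (A * 2 ^ K <= \sum_(n < M) 2 ^ (K + x n - y n))%N.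
  have [||M hM] := @nneseries_gt_partial R (fun n => 2 ^ ((x n)%:Z - (y n)%:Z)) 0 A%:R.
  - by move=> n; rewrite exprz_ge0.
  - by rewrite xy_sum ltry.
  exists M => K yK; rewrite -(ler_nat R) natrM natr_sum natrX mulrC.
  under [X in _ <= X]eq_bigr => n _ do rewrite term_eq ?yK //.
  rewrite -big_distrr /= ler_wpM2l ?exprn_ge0 // ltW //.
  by move: hM; rewrite big_mkord.
(* Richness is decidable and reached for every [c], so a search yields the stages computably. *)
have [|Kf rK richK] := mu_total (rec_rich rf rg).
  by move=> c; exact: (rich_exists c xy_distinct x_le_y f_ev g_ev unbounded).
split; first exact: (B_gt_BP' HD Hm.1 rf rg rK fx gy richK).
exact: (BP'_gt_BP HP Hm rf rg rK x_le_y fx gy richK).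
Qed.
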